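(* Let $\Omega\subseteq\mathbb{H}$ be a symmetric slice domain. The set of $*$-quotients $$\mathcal{L}(\Omega)=\{f^{-*}*g:\ f,g\text{ regular in }\Omega,\ f\not\equiv0\}$$ is a division ring with respect to $+,*$. Moreover, the ring of regular functions on $\Omega$ (with operations $+,*$) is a left and right Ore domain and $\mathcal{L}(\Omega)$ is its classical ring of quotients.
   Context: $\mathbb{H}$ denotes the quaternions and $\mathbb{S}=\{q\in\mathbb{H}:q^2=-1\}$. For $\Omega\subseteq\mathbb{H}$ and $I\in\mathbb{S}$ put $\Omega_I=\Omega\cap(\mathbb{R}+I\mathbb{R})$ and $f_I=f|_{\Omega_I}$. A function $f_I$ is holomorphic if it has continuous partial derivatives and $\frac12\left(\frac{\partial}{\partial x}+I\frac{\partial}{\partial y}\right)f_I(x+Iy)\equiv0$; a function $f:\Omega\to\mathbb{H}$ on an open set $\Omega$ is regular if $f_I$ is holomorphic for all $I\in\mathbb{S}$. A set is symmetric if together with each $x+Iy$ it contains $x+y\mathbb{S}=\{x+Jy:J\in\mathbb{S}\}$. A domain (connected open set) $\Omega$ is a slice domain if it meets the real axis and every $\Omega_I$ is a domain in $\mathbb{R}+I\mathbb{R}$. On a symmetric slice domain $\Omega$, every holomorphic $\phi:\Omega_I\to\mathbb{H}$ has a unique regular extension $\mathrm{ext}(\phi)$ to $\Omega$. For $f,g$ regular on $\Omega$ and $I\perp J$ in $\mathbb{S}$, write $f_I=F+GJ$, $g_I=H+KJ$ with $F,G,H,K:\Omega_I\to\mathbb{R}+I\mathbb{R}$ holomorphic;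 then (independently of $I,J$) $$f*g=\mathrm{ext}\left(\left[F(z)H(z)-G(z)\overline{K(\bar z)}\right]+\left[F(z)K(z)+G(z)\overline{H(\bar z)}\right]J\right),\qquad f^c=\mathrm{ext}\left(\overline{F(\bar z)}-G(z)J\right),$$ and $f^s=f*f^c=f^c*f$. With $+,*$ the regular functions on $\Omega$ form a ring. If $f\not\equiv0$, the regular reciprocal of $f$ is $f^{-*}=\frac1{f^s}f^c$, a regular function on the symmetric slice domain $\Omega\setminus Z_{f^s}$, where $Z_{f^s}$ is the zero set of $f^s$; the quotient $f^{-*}*g$ is a regular function on $\Omega\setminus Z_{f^s}$. The sum and $*$-product of $f^{-*}*g$ and $h^{-*}*k$ are computed on the symmetric slice domain $\Omega\setminus(Z_{f^s}\cup Z_{h^s})$, and two elements of $\mathcal{L}(\Omega)$ are identified when they coincide on their common domain of definition. A left (resp. right) Ore domain is a ring $D$ with no zero divisors such that $Da\cap Db\neq\{0\}$ (resp. $aD\cap bD\ne\{0\}$) for all $a,b\in D\setminus\{0\}$. The classical left ring of quotients of a left Ore domain $D$ is the (unique up to isomorphism) skew field $L$ of formal quotients $a^{-1}b$ ($a,b\in D$, $a\neq0$), containing $D$ as the subring $\{1^{-1}a:a\in D\}$; the classical right ring of quotients is defined similarly. If $D$ is both left and right Ore the two are isomorphic and one speaks of the classical ring of quotients of $D$. *)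

(* Defs.v *)
From HB Require Import structures.
From mathcomp Require Import all_boot all_order all_algebra.
From mathcomp Require Import all_classical all_reals all_analysis.
From mathcomp Require Import ring lra.
Set Implicit Arguments.
Unset Strict Implicit.
Unset Printing Implicit Defensive.
Import Order.TTheory GRing.Theory Num.Theory.
Import numFieldNormedType.Exports.
Local Open Scope classical_set_scope.
Local Open Scope ring_scope.

(* The row vector (a, b, c, d) stands for a + b i + c j + d k. The norm inherited
   from row vectors is the sup norm, which induces the Euclidean topology. *)
Definition quat (R : realType) := 'rV[R]_4.

HB.instance Definition _ (R : realType) :=
  NormedModule.copy (quat R) 'rV[R]_4.

Definition mkquat (R : realType) (a b c d : R) : quat R :=
  \row_(i < 4) [:: a; b; c; d]`_i.

Definition qone (R : realType) : quat R := mkquat 1 0 0 0.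

Definition qmul (R : realType) (p q : quat R) : quat R :=
  let a := p 0 0 in let b := p 0 1 in let c := p 0 2 in let d := p 0 3 in
  let a' := q 0 0 in let b' := q 0 1 in let c' := q 0 2 in let d' := q 0 3 in
  mkquat (a * a' - b * b' - c * c' - d * d')
         (a * b' + b * a' + c * d' - d * c')
         (a * c' - b * d' + c * a' + d * b')
         (a * d' + b * c' - c * b' + d * a').

Definition qconj (R : realType) (q : quat R) : quat R :=
  mkquat (q 0 0) (- q 0 1) (- q 0 2) (- q 0 3).

Definition qdot (R : realType) (p q : quat R) : R := \sum_i p 0 i * q 0 i.

Definition qinv (R : realType) (q : quat R) : quat R :=
  (qdot q q)^-1 *: qconj q.

Lemma mkquatE (R : realType) (a b c d : R) :
  ((mkquat a b c d 0 0 = a) * (mkquat a b c d 0 1 = b) *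
   (mkquat a b c d 0 2 = c) * (mkquat a b c d 0 3 = d))%type.
Proof. by rewrite !mxE. Qed.

Lemma quatP (R : realType) (p q : quat R) :
  p 0 0 = q 0 0 -> p 0 1 = q 0 1 -> p 0 2 = q 0 2 -> p 0 3 = q 0 3 -> p = q.
Proof.
move=> e0 e1 e2 e3; apply/rowP => i.
case: i => -[|[|[|[|//]]]] lti.
- by rewrite (_ : Ordinal lti = 0) //; apply: val_inj.
- by rewrite (_ : Ordinal lti = 1) //; apply: val_inj.
- by rewrite (_ : Ordinal lti = 2) //; apply: val_inj.
- by rewrite (_ : Ordinal lti = 3) //; apply: val_inj.
Qed.

Lemma quat_eta (R : realType) (q : quat R) :
  q = mkquat (q 0 0) (q 0 1) (q 0 2) (q 0 3).
Proof. by apply: quatP; rewrite mkquatE. Qed.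

Lemma qdotE (R : realType) (p q : quat R) :
  qdot p q =
  p 0 0 * q 0 0 + p 0 1 * q 0 1 + p 0 2 * q 0 2 + p 0 3 * q 0 3.
Proof.
rewrite /qdot !big_ord_recr big_ord0 /= add0r.
by congr (_ + _ + _ + _); congr (p _ _ * q _ _); apply: val_inj.
Qed.

Lemma qaddE (R : realType) (p q : quat R) i : (p + q) 0 i = p 0 i + q 0 i.
Proof. exact: mxE. Qed.

Lemma qoppE (R : realType) (q : quat R) i : (- q) 0 i = - q 0 i.
Proof. exact: mxE. Qed.

Lemma qscaleE (R : realType) (t : R) (q : quat R) i : (t *: q) 0 i = t * q 0 i.
Proof. exact: mxE. Qed.

Lemma qmulA (R : realType) : associative (@qmul R).
Proof. by move=> p q r; apply: quatP; rewrite /qmul !mkquatE; ring. Qed.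

Lemma qmul1q (R : realType) : left_id (qone R) (@qmul R).
Proof. by move=> q; apply: quatP; rewrite /qmul /qone !mkquatE; ring. Qed.

Lemma qmulq1 (R : realType) : right_id (qone R) (@qmul R).
Proof. by move=> q; apply: quatP; rewrite /qmul /qone !mkquatE; ring. Qed.

Lemma qmulDl (R : realType) : left_distributive (@qmul R) +%R.
Proof.
by move=> p q r; apply: quatP; rewrite qaddE /qmul !mkquatE !qaddE; ring.
Qed.

Lemma qmulDr (R : realType) : right_distributive (@qmul R) +%R.
Proof.
by move=> p q r; apply: quatP; rewrite qaddE /qmul !mkquatE !qaddE; ring.
Qed.

Lemma qone_neq0 (R : realType) : qone R != 0.
Proof.
apply/eqP => /(congr1 (fun q : quat R => q 0 0)).
by rewrite mkquatE mxE => /eqP; rewrite oner_eq0.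
Qed.

HB.instance Definition _ (R : realType) :=
  GRing.Zmodule_isNzRing.Build (quat R)
    (@qmulA R) (@qmul1q R) (@qmulq1 R) (@qmulDl R) (@qmulDr R) (@qone_neq0 R).

Lemma qmulE (R : realType) (p q : quat R) : p * q = qmul p q.
Proof. by []. Qed.

Lemma qoneE (R : realType) : (1 : quat R) = mkquat 1 0 0 0.
Proof. by []. Qed.

Lemma qscaleAl (R : realType) (t : R) (p q : quat R) :
  t *: (p * q) = t *: p * q.
Proof. by apply: quatP; rewrite !qmulE /qmul !(qscaleE, mkquatE); ring. Qed.

Lemma qscaleAr (R : realType) (t : R) (p q : quat R) :
  t *: (p * q) = p * (t *: q).
Proof. by apply: quatP; rewrite !qmulE /qmul !(qscaleE, mkquatE); ring. Qed.

HB.instance Definition _ (R : realType) :=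
  GRing.Lmodule_isLalgebra.Build R (quat R) (@qscaleAl R).
HB.instance Definition _ (R : realType) :=
  GRing.Lalgebra_isAlgebra.Build R (quat R) (@qscaleAr R).

Lemma qdot_eq0 (R : realType) (q : quat R) : (qdot q q == 0) = (q == 0).
Proof.
rewrite qdotE; apply/eqP/eqP => [h|->]; last by rewrite !mxE; ring.
by apply: quatP; rewrite mxE; apply/eqP; rewrite -sqrf_eq0; apply/eqP; nra.
Qed.

Lemma qmulVq (R : realType) :
  {in [pred q : quat R | q != 0], left_inverse 1 (@qinv R) *%R}.
Proof.
move=> q; rewrite inE -qdot_eq0 qdotE => n0.
by rewrite qmulE qoneE /qinv qdotE; apply: quatP;
  rewrite /qmul !(qscaleE, mkquatE); field.
Qed.

Lemma qmulqV (R : realType) :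
  {in [pred q : quat R | q != 0], right_inverse 1 (@qinv R) *%R}.
Proof.
move=> q; rewrite inE -qdot_eq0 qdotE => n0.
by rewrite qmulE qoneE /qinv qdotE; apply: quatP;
  rewrite /qmul !(qscaleE, mkquatE); field.
Qed.

Lemma qunitP (R : realType) (p q : quat R) :
  q * p = 1 /\ p * q = 1 -> p \in [pred q : quat R | q != 0].
Proof.
rewrite inE => -[+ _]; apply: contra_eqN => /eqP ->.
by rewrite mulr0 eq_sym oner_eq0.
Qed.

Lemma qinv_out (R : realType) :
  {in [predC [pred q : quat R | q != 0]], @qinv R =1 id}.
Proof.
move=> q; rewrite !inE negbK => /eqP ->.
by rewrite /qinv; apply: quatP; rewrite qscaleE /qconj !mkquatE !mxE; ring.
Qed.

HB.instance Definition _ (R : realType) :=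
  GRing.NzRing_hasMulInverse.Build (quat R)
    (@qmulVq R) (@qmulqV R) (@qunitP R) (@qinv_out R).

Definition imag_unit (R : realType) : set (quat R) := [set q | q ^+ 2 = -1].

Definition qpoint (R : realType) (I : quat R) (z : R * R) : quat R :=
  z.1%:A + z.2 *: I.

(* Omega_I in the coordinates (x, y) of x + I y; for I an imaginary unit these
   identify R + I R with R * R as topological spaces. *)
Definition slice (R : realType) (Omega : set (quat R)) (I : quat R) :
    set (R * R) :=
  [set z | Omega (qpoint I z)].

Definition domain (T : topologicalType) (A : set T) := open A /\ connected A.

Definition symmetric_set (R : realType) (Omega : set (quat R)) :=
  forall (I J : quat R) (z : R * R), imag_unit I -> imag_unit J ->
    Omega (qpoint I z) -> Omega (qpoint J z).

Definition slice_domain (R : realType) (Omega : set (quat R)) :=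
  [/\ domain Omega,
      exists x : R, Omega x%:A
    & forall I, imag_unit I -> domain (slice Omega I)].

Definition holomorphic (R : realType) (I : quat R) (U : set (R * R))
    (phi : R * R -> quat R) :=
  forall z, U z ->
  [/\ derivable phi z (1, 0) /\ derivable phi z (0, 1),
      {for z, continuous ('D_(1, 0) phi)},
      {for z, continuous ('D_(0, 1) phi)}
    & 2^-1 *: ('D_(1, 0) phi z + I * 'D_(0, 1) phi z) = 0].

(* Functions on Omega are total functions whose values off Omega are
   irrelevant. *)
Definition regular (R : realType) (Omega : set (quat R))
    (f : quat R -> quat R) :=
  forall I, imag_unit I -> holomorphic I (slice Omega I) (f \o qpoint I).

(* On a symmetric slice domain every holomorphic phi has a regular extension,
   unique on Omega; the default value only serves to make [ext] total. *)
Definition ext (R : realType) (Omega : set (quat R)) (I : quat R)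
    (phi : R * R -> quat R) : quat R -> quat R :=
  xget (fun=> 0)
    [set h | regular Omega h /\
             forall z, slice Omega I z -> h (qpoint I z) = phi z].

(* For orthogonal imaginary units I, J, the quaternions 1, I, J, I * J form an
   orthonormal basis, hence q = fst_part I q + snd_part I J q * J with both
   parts in R + I R. *)
Definition fst_part (R : realType) (I q : quat R) : quat R :=
  qpoint I (qdot q 1, qdot q I).

Definition snd_part (R : realType) (I J q : quat R) : quat R :=
  qpoint I (qdot q J, qdot q (I * J)).

Lemma imag_unitP (R : realType) (q : quat R) : imag_unit q ->
  q 0 0 = 0 /\ (q 0 1) ^+ 2 + (q 0 2) ^+ 2 + (q 0 3) ^+ 2 = 1.
Proof.
rewrite /imag_unit/= expr2 qmulE qoneE => h.
have := congr1 (fun p : quat R => p 0 0) h.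
have := congr1 (fun p : quat R => p 0 1) h.
have := congr1 (fun p : quat R => p 0 2) h.
have := congr1 (fun p : quat R => p 0 3) h.
rewrite /qmul !qoppE !mkquatE => h3 h2 h1 h0.
have a0 : q 0 0 = 0.
  apply/eqP; apply: contraT => a0.
  have z x : q 0 0 * x = 0 -> x = 0.
    by move/eqP; rewrite mulf_eq0 (negbTE a0) /= => /eqP.
  have b0 : q 0 1 = 0 by apply: z; lra.
  have c0 : q 0 2 = 0 by apply: z; lra.
  have d0 : q 0 3 = 0 by apply: z; lra.
  by move: h0; rewrite b0 c0 d0; nra.
by split => //; move: h0; rewrite a0; lra.
Qed.

Lemma partE (R : realType) (I J q : quat R) :
  imag_unit I -> imag_unit J -> qdot I J = 0 ->
  q = fst_part I q + snd_part I J q * J.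
Proof.
move=> /imag_unitP[I0 hI] /imag_unitP[J0 hJ].
rewrite qdotE I0 J0 mulr0 add0r => hIJ.
have E k : (fst_part I q + snd_part I J q * J) 0 k =
    qdot q 1 * (1 : quat R) 0 k + qdot q I * I 0 k +
    (qdot q J * J 0 k + qdot q (I * J) * (I * J) 0 k).
  by rewrite /fst_part /snd_part /qpoint mulrDl -!scalerAl mul1r
    !(qaddE, qscaleE).
apply: quatP; rewrite E !qdotE !qoneE !qmulE /qmul !mkquatE ?I0 ?J0;
  move: (q 0 0) (q 0 1) (q 0 2) (q 0 3) (I 0 1) (I 0 2) (I 0 3)
    (J 0 1) (J 0 2) (J 0 3) hI hJ hIJ => x0 x1 x2 x3 b1 b2 b3 c1 c2 c3 hI hJ d0;
  set nI := (X in X = 1) in hI; set nJ := (X in X = 1) in hJ;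
  set d := (X in X = 0) in d0.
- transitivity (x0 + (x0 * d - x1 * (b2 * c3 - b3 * c2)
      - x2 * (b3 * c1 - b1 * c3) - x3 * (b1 * c2 - b2 * c1)) * d).
    by rewrite d0; ring.
  by rewrite /d; ring.
- transitivity (x1 * (nI * nJ - d ^+ 2)
      + (1 - nJ) * (x1 * b1 + x2 * b2 + x3 * b3) * b1
      + (1 - nI) * (x1 * c1 + x2 * c2 + x3 * c3) * c1
      + d * ((x1 * b1 + x2 * b2 + x3 * b3) * c1
             + (x1 * c1 + x2 * c2 + x3 * c3) * b1 - x0 * (b2 * c3 - b3 * c2))).
    by rewrite hI hJ d0; ring.
  by rewrite /nI /nJ /d; ring.
- transitivity (x2 * (nI * nJ - d ^+ 2)
      + (1 - nJ) * (x1 * b1 + x2 * b2 + x3 * b3) * b2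
      + (1 - nI) * (x1 * c1 + x2 * c2 + x3 * c3) * c2
      + d * ((x1 * b1 + x2 * b2 + x3 * b3) * c2
             + (x1 * c1 + x2 * c2 + x3 * c3) * b2 - x0 * (b3 * c1 - b1 * c3))).
    by rewrite hI hJ d0; ring.
  by rewrite /nI /nJ /d; ring.
- transitivity (x3 * (nI * nJ - d ^+ 2)
      + (1 - nJ) * (x1 * b1 + x2 * b2 + x3 * b3) * b3
      + (1 - nI) * (x1 * c1 + x2 * c2 + x3 * c3) * c3
      + d * ((x1 * b1 + x2 * b2 + x3 * b3) * c3
             + (x1 * c1 + x2 * c2 + x3 * c3) * b3 - x0 * (b1 * c2 - b2 * c1))).
    by rewrite hI hJ d0; ring.
  by rewrite /nI /nJ /d; ring.
Qed.


(* On R + I R, complex conjugation is the restriction of [qconj]. *)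
Definition star (R : realType) (I J : quat R) (Omega : set (quat R))
    (f g : quat R -> quat R) : quat R -> quat R :=
  let F z := fst_part I (f (qpoint I z)) in
  let G z := snd_part I J (f (qpoint I z)) in
  let H z := fst_part I (g (qpoint I z)) in
  let K z := snd_part I J (g (qpoint I z)) in
  let bar (z : R * R) := (z.1, - z.2) in
  ext Omega I (fun z =>
    (F z * H z - G z * qconj (K (bar z))) +
    (F z * K z + G z * qconj (H (bar z))) * J).

Definition conjugate (R : realType) (I J : quat R) (Omega : set (quat R))
    (f : quat R -> quat R) : quat R -> quat R :=
  let F z := fst_part I (f (qpoint I z)) in
  let G z := snd_part I J (f (qpoint I z)) in
  let bar (z : R * R) := (z.1, - z.2) in
  ext Omega I (fun z => qconj (F (bar z)) - G z * J).

Definition symmetrization (R : realType) (I J : quat R)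
    (Omega : set (quat R)) (f : quat R -> quat R) : quat R -> quat R :=
  star I J Omega f (conjugate I J Omega f).

Definition zero_set (R : realType) (Omega : set (quat R))
    (f : quat R -> quat R) : set (quat R) :=
  [set q | Omega q /\ f q = 0].

Definition reciprocal (R : realType) (I J : quat R) (Omega : set (quat R))
    (f : quat R -> quat R) : quat R -> quat R :=
  fun q => (symmetrization I J Omega f q)^-1 * conjugate I J Omega f q.

Record pfun (R : realType) :=
  PFun { dom : set (quat R); fn : quat R -> quat R }.

Definition quotient (R : realType) (I J : quat R) (Omega : set (quat R))
    (f g : quat R -> quat R) : pfun R :=
  let U := Omega `\` zero_set Omega (symmetrization I J Omega f) in
  PFun U (star I J U (reciprocal I J Omega f) g).

Definition coincide (R : realType) (p q : pfun R) :=
  forall x, (dom p `&` dom q) x -> fn p x = fn q x.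

Definition psum (R : realType) (p q : pfun R) : pfun R :=
  PFun (dom p `&` dom q) (fun x => fn p x + fn q x).

Definition pprod (R : realType) (I J : quat R) (p q : pfun R) : pfun R :=
  PFun (dom p `&` dom q) (star I J (dom p `&` dom q) (fn p) (fn q)).

Definition regular_functions (R : realType) (Omega : set (quat R)) :
    set (pfun R) :=
  [set p | dom p = Omega /\ regular Omega (fn p)].

Definition star_quotients (R : realType) (I J : quat R)
    (Omega : set (quat R)) : set (pfun R) :=
  [set p | exists f g, [/\ regular Omega f, regular Omega g,
    exists2 q, Omega q & f q != 0 & p = quotient I J Omega f g]].

(* [cls] exhibits the ring [A] as the set [X], its elements being identified
   when they coincide, with the operations [psum] and [pprod]. *)
Definition presents (R : realType) (I J : quat R) (X : set (pfun R))
    (A : nzRingType) (cls : pfun R -> A) :=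
  [/\ forall a : A, exists2 p, X p & cls p = a,
      forall p q, X p -> X q -> (cls p = cls q <-> coincide p q),
      forall p q r, X p -> X q -> X r ->
        (cls r = cls p + cls q <-> coincide r (psum p q))
    & forall p q r, X p -> X q -> X r ->
        (cls r = cls p * cls q <-> coincide r (pprod I J p q))].

(* [GRing.field_axiom] and [GRing.integral_domain_axiom] do not include
   commutativity. *)
Definition division_ring (L : unitRingType) := GRing.field_axiom L.

Definition left_Ore_domain (D : nzRingType) :=
  GRing.integral_domain_axiom D /\
  forall a b : D, a != 0 -> b != 0 ->
    exists2 c, c != 0 & (exists u, c = u * a) /\ (exists v, c = v * b).

Definition right_Ore_domain (D : nzRingType) :=
  GRing.integral_domain_axiom D /\
  forall a b : D, a != 0 -> b != 0 ->
    exists2 c, c != 0 & (exists u, c = a * u) /\ (exists v, c = b * v).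

Definition left_quotient_ring (D : nzRingType) (L : unitRingType)
    (iota : {rmorphism D -> L}) :=
  [/\ division_ring L, injective iota
    & forall x : L, exists a b : D, a != 0 /\ x = (iota a)^-1 * iota b].

Definition right_quotient_ring (D : nzRingType) (L : unitRingType)
    (iota : {rmorphism D -> L}) :=
  [/\ division_ring L, injective iota
    & forall x : L, exists a b : D, a != 0 /\ x = iota b * (iota a)^-1].

(* Main.v *)
From HB Require Import structures.
From mathcomp Require Import all_boot all_order all_algebra.
From mathcomp Require Import all_classical all_reals all_analysis.
From mathcomp Require Import complex ring lra.
Require Import Defs.
Set Implicit Arguments.
Unset Strict Implicit.
Unset Printing Implicit Defensive.
Import Order.TTheory GRing.Theory Num.Theory.
Import numFieldNormedType.Exports.
Local Open Scope classical_set_scope.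
Local Open Scope ring_scope.

(* A regular function on a symmetric slice domain is given by
   f(x + y K) = alpha(x, y) + K beta(x, y) for every imaginary unit K, where the
   stem alpha + i beta takes values in H (x) C, hence is a quadruple of complex
   holomorphic functions c with c(conj z) = conj c(z) on the slice D. The
   star product is the pointwise product of stems, so the ring of regular
   functions is the quaternion algebra over the commutative ring T of such
   functions c. Unique continuation makes T an integral domain; on the real axis
   its elements are real, so a sum of four squares vanishes in T only trivially.
   Hence the quaternions over Frac T form a division ring, and they are the ring
   of quotients. Since f^s is the quaternion norm of the stem of f, the quotient
   f^-* * g is the fraction of (conjugate of f) g by f^s; it is determined by its
   values because D remains connected after removing the zeros of f^s.

   Unique continuation is derived without integrals: averages over the n-th
   roots of unity give the mean value inequality for C^1 solutions of the
   Cauchy-Riemann equations, and applying it to c(z) (z - w')^-n propagates the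
   zero set from one disc to a slightly larger one. *)

Local Notation Re := (@complex.Re _).
Local Notation Im := (@complex.Im _).

(** * Continuously differentiable functions of two real variables *)

(** Inverses cannot be found pointwise. Quaternions with complex coefficients have zero divisors,
    and off the real axis the stem of a nonzero regular function may take nonzero values of norm 0.
    So division happens in the fractions of the whole ring of functions, where being nonzero is a
    global condition. The other obstacle is the varying domains. A star quotient lives exactly where
    its symmetrization is nonzero, even if its singularities are removable, and elements are
    compared only on common domains. Each partial function is therefore tied to a pair: a nonzero
    central denominator, whose zeros fix the domain, and a quaternionic numerator. Two denominators
    have a nonzero product, so common domains are never empty, and coincidence on them turns into
    equality after cross-multiplication over the whole slice. The operator [ext] is a bare choice.
    Its values become accessible by exhibiting the function of a stem as one regular extension and
    by proving that there is no other. *)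

Lemma is_derive_line (R : realType) (u : R * R -> R) (z e : R * R) (t : R) :
  derivable u (z + t *: e) e ->
  is_derive t 1 (fun s : R => u (z + s *: e)) ('D_e u (z + t *: e)).
Proof.
move=> du; have E : (fun h : R => h^-1 *:
     (((fun s : R => u (z + s *: e)) \o shift t) (h *: 1) - u (z + t *: e))) =
   (fun h : R => h^-1 *: ((u \o shift (z + t *: e)) (h *: e) - u (z + t *: e))).
  apply/funext => h /=; congr (_ *: (u _ - _)).
  by rewrite scalerDl [h *: 1]mulr1 addrCA.
by split; rewrite /derivable /derive E.
Qed.

(** The mean value theorem on the segment from [z] to [z + h *: e]. The sign of [h] is split because
    the theorem wants ordered endpoints. *)
Lemma directional_mvt (R : realType) (u : R * R -> R) (z e : R * R)
    (h eps c : R) :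
  (forall t : R, `|t| <= `|h| ->
    derivable u (z + t *: e) e /\ `|'D_e u (z + t *: e) - c| <= eps) ->
  `|u (z + h *: e) - u z - c * h| <= eps * `|h|.
Proof.
move=> H; pose g (s : R) := u (z + s *: e).
have dg (t : R) : `|t| <= `|h| -> is_derive t 1 g ('D_e u (z + t *: e)).
  by move=> /H[dt _]; exact: is_derive_line.
have cg (t : R) : `|t| <= `|h| -> {for t, continuous g}.
  by move=> /dg[dt _]; apply: differentiable_continuous; apply/derivable1_diffP.
have [h0|h0] := leP 0 h.
  have sub (t : R) : t \in `[0, h] -> `|t| <= `|h|.
    by rewrite in_itv/= => /andP[t0 th]; rewrite !ger0_norm.
  have [||t th] := @MVT_segment R g (fun t : R => 'D_e u (z + t *: e)) 0 h h0.
  - by move=> t th; apply/dg/sub; exact: subset_itv_oo_cc th.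
  - apply: continuous_in_subspaceT => t; rewrite inE/= => th.
    exact/cg/sub.
  rewrite subr0 {1 2}/g scale0r addr0 => ->; rewrite -mulrBl normrM.
  by apply: ler_wpM2r => //; have [] := H t (sub t th).
have h0' := ltW h0.
have sub (t : R) : t \in `[h, 0] -> `|t| <= `|h|.
  by rewrite in_itv/= => /andP[th t0]; rewrite !ler0_norm// lerN2.
have [||t th] := @MVT_segment R g (fun t : R => 'D_e u (z + t *: e)) h 0 h0'.
- by move=> t th; apply/dg/sub; exact: subset_itv_oo_cc th.
- apply: continuous_in_subspaceT => t; rewrite inE/= => th.
  exact/cg/sub.
rewrite sub0r {1 2}/g scale0r addr0 => E.
have -> : u (z + h *: e) - u z = 'D_e u (z + t *: e) * h.
  by rewrite -opprB E mulrN opprK.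
by rewrite -mulrBl normrM; apply: ler_wpM2r => //; have [] := H t (sub t th).
Qed.

(** The differential of a function with partial derivatives [a] and [b], named so that it can carry
    the linear structure required of a differential. *)
Definition plane_form (R : realType) (a b : R) (v : R * R) : R :=
  v.1 * a + v.2 * b.

Lemma plane_form_linear (R : realType) (a b : R) : linear (plane_form a b).
Proof.
move=> k [v1 v2] [w1 w2].
have E : ((k : R) * v1 + w1) * a + (k * v2 + w2) * b =
  k * (v1 * a + v2 * b) + (w1 * a + w2 * b) by ring.
exact: E.
Qed.

HB.instance Definition _ (R : realType) (a b : R) :=
  GRing.isLinear.Build R (R * R)%type R *:%R (plane_form a b)
    (@plane_form_linear R a b).

Lemma continuous_plane_form (R : realType) (a b : R) :
  continuous (plane_form a b : R * R -> R).
Proof.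
move=> v; apply: cvgD; apply: cvgM.
- exact: cvg_fst.
- exact: cvg_cst.
- exact: cvg_snd.
- exact: cvg_cst.
Qed.

Definition C1 (R : realType) (D : set (R * R)) (u : R * R -> R) :=
  forall z, D z ->
  [/\ derivable u z (1, 0), derivable u z (0, 1),
      {for z, continuous ('D_(1, 0) u)} & {for z, continuous ('D_(0, 1) u)}].

(** The increment is cut into a horizontal and a vertical leg; on each of them continuity of the
    partial derivative and [directional_mvt] bound the error. *)
Lemma C1_diff (R : realType) (D : set (R * R)) (u : R * R -> R) z :
  open D -> C1 D u -> D z ->
  is_diff z u (plane_form ('D_(1, 0) u z) ('D_(0, 1) u z)).
Proof.
move=> oD cu Dz; have [_ _ c1 c2] := cu z Dz.
set a := 'D_(1, 0) u z; set b := 'D_(0, 1) u z.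
have E : u \o shift z = cst (u z) + (plane_form a b : R * R -> R) +o_ (0 : R * R) id.
  apply/eqaddoP => e e0; have e20 : 0 < e / 2 by rewrite divr_gt0.
  have /nbhs_ballP[d /= d0 dD] : nbhs z (D `&`
      [set w | `|'D_(1, 0) u w - a| <= e / 2 /\ `|'D_(0, 1) u w - b| <= e / 2]).
    apply: filterI; first exact: open_nbhs_nbhs.
    apply: filterI.
      by near=> w; rewrite /= distrC; near: w; move/cvgrPdist_le : c1; apply.
    by near=> w; rewrite /= distrC; near: w; move/cvgrPdist_le : c2; apply.
  apply/nbhs_ballP; exists d => // -[k1 k2]; rewrite -ball_normE /ball_/= sub0r normrN.
  rewrite prod_normE/= gt_max => /andP[k1d k2d].
  have B (s t : R) : `|s| <= `|k1| -> `|t| <= `|k2| -> ball z d (z + (s, t)).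
    move=> sk tk; rewrite -ball_normE/= opprD addrA subrr sub0r normrN.
    by rewrite prod_normE/= gt_max (le_lt_trans sk) ?(le_lt_trans tk).
  have m1 : `|u (z + k1 *: (1, 0)) - u z - a * k1| <= e / 2 * `|k1|.
    apply: directional_mvt => t tk.
    have /dD[Dt [Dh _]] : ball z d (z + t *: (1, 0)).
      have -> : t *: (1, 0) = (t, 0) :> R * R.
        by congr pair; rewrite /= ?[_ *: _]mulr1 // scaler0.
      by apply: B; rewrite ?normr0.
    by have [du _ _ _] := cu _ Dt; exact: (conj du Dh).
  have m2 : `|u (z + k1 *: (1, 0) + k2 *: (0, 1)) - u (z + k1 *: (1, 0)) -
       b * k2| <= e / 2 * `|k2|.
    apply: directional_mvt => t tk.
    have /dD[Dt [_ Dh]] : ball z d (z + k1 *: (1, 0) + t *: (0, 1)).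
      have -> : z + k1 *: (1, 0) + t *: (0, 1) = z + (k1, t) :> R * R.
        rewrite -addrA; congr (_ + _); congr pair; rewrite /= ?scaler0.
        - by rewrite addr0 [_ *: _]mulr1.
        - by rewrite add0r [_ *: _]mulr1.
      exact: B.
    by have [_ du _ _] := cu _ Dt; exact: (conj du Dh).
  have -> : (u \o shift z - (cst (u z) + plane_form a b)) (k1, k2) =
      u (z + k1 *: (1, 0) + k2 *: (0, 1)) - u z - a * k1 - b * k2.
    have -> : z + k1 *: (1, 0) + k2 *: (0, 1) = (k1, k2) + z :> R * R.
      rewrite [RHS]addrC -addrA; congr (_ + _); congr pair; rewrite /= scaler0.
      - by rewrite addr0 [_ *: _]mulr1.
      - by rewrite add0r [_ *: _]mulr1.
    transitivity (u ((k1, k2) + z) - (u z + (k1 * a + k2 * b))); first by [].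
    by ring.
  rewrite /=.
  set A := u (z + k1 *: (1, 0)) in m1 m2; set B' := u (_ + _ + _) in m2 *.
  have -> : B' - u z - a * k1 - b * k2 = (A - u z - a * k1) + (B' - A - b * k2).
    by ring.
  apply: le_trans (ler_normD _ _) _; apply: le_trans (lerD m1 m2) _.
  (* The norm of the plane is the maximum of the coordinates, so the two legs together are at most
     twice the norm of the increment; hence the [e / 2] on each leg. *)
  rewrite -mulrDr mulrAC ler_pdivrMr// -mulrA; apply: ler_wpM2l; first exact: ltW.
  move: (`|k1|) (`|k2|) => p q; rewrite mulr_natr mulr2n; apply: lerD; rewrite le_max lexx ?orbT//.
have cdf := @continuous_plane_form R a b.
have dE : 'd u z = plane_form a b :> (R * R -> R) by exact: diff_unique.
split=> //; apply/diff_locallyP; rewrite dE; split => //.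
Unshelve. all: by end_near. Qed.

(** Carrying the partial derivatives as explicit functions reduces the calculus rules and the
    Cauchy-Riemann equations to pointwise identities on [D], discharged through [C1_with_eq]. *)
Definition C1_with (R : realType) (D : set (R * R)) (u p q : R * R -> R) :=
  forall z, D z ->
  [/\ is_derive z (1, 0) u (p z), is_derive z (0, 1) u (q z),
      {for z, continuous p} & {for z, continuous q}].

Section C1_calculus.
Context {R : realType} (D : set (R * R)).
Hypothesis oD : open D.
Implicit Types (u v p q r s : R * R -> R) (z w : R * R).

Lemma near_open z : D z -> \forall w \near z, D w.
Proof. by move=> Dz; apply: open_nbhs_nbhs. Qed.

Lemma for_continuous_eq u v z : D z -> (forall w, D w -> u w = v w) ->
  {for z, continuous u} -> {for z, continuous v}.
Proof.
move=> Dz uv cu; change (v @ z --> v z); rewrite -(uv z Dz); apply: cvg_trans cu.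
by apply: near_eq_cvg; near=> w; apply: uv; near: w; exact: near_open.
Unshelve. all: by end_near. Qed.

Lemma C1_withP u : C1 D u <-> C1_with D u ('D_(1, 0) u) ('D_(0, 1) u).
Proof.
split=> H z Dz.
  have [d1 d2 c1 c2] := H z Dz.
  exact: (And4 (derivableP d1) (derivableP d2) c1 c2).
by have [[d1 _] [d2 _] c1 c2] := H z Dz; exact: (And4 d1 d2 c1 c2).
Qed.

Lemma C1_with_eq u v p q r s :
  (forall z, D z -> [/\ u z = v z, p z = r z & q z = s z]) ->
  C1_with D u p q -> C1_with D v r s.
Proof.
move=> E H z Dz; have [d1 d2 c1 c2] := H z Dz; have [_ <- <-] := E z Dz.
have uv : \forall w \near z, u w = v w.
  near=> w; have Dw : D w by near: w; exact: near_open.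
  by have [-> _ _] := E w Dw.
split.
- exact: near_eq_is_derive uv d1.
- exact: near_eq_is_derive uv d2.
- by apply: for_continuous_eq c1 => // w /E[].
- by apply: for_continuous_eq c2 => // w /E[].
Unshelve. all: by end_near. Qed.

Lemma C1_with_C1 u p q : C1_with D u p q -> C1 D u.
Proof.
move=> H; apply/C1_withP; apply: (C1_with_eq _ (H)) => z Dz.
by have [[_ ->] [_ ->] _ _] := H z Dz.
Qed.

Lemma C1_with_diff u p q z : C1_with D u p q -> D z ->
  is_diff z u (plane_form (p z) (q z)).
Proof.
move=> H Dz; have [[_ <-] [_ <-] _ _] := H z Dz.
exact: C1_diff (C1_with_C1 H) Dz.
Qed.

Lemma C1_with_continuous u p q z : C1_with D u p q -> D z ->
  {for z, continuous u}.
Proof.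
move=> H Dz; have /@ex_diff := C1_with_diff H Dz.
exact: differentiable_continuous.
Qed.

Lemma C1_with_cst (k : R) : C1_with D (fun=> k) (fun=> 0) (fun=> 0).
Proof. by move=> z _; split; try exact: is_derive_cst; exact: cvg_cst. Qed.

Lemma C1_withD u p q v r s : C1_with D u p q -> C1_with D v r s ->
  C1_with D (fun z => u z + v z) (fun z => p z + r z) (fun z => q z + s z).
Proof.
move=> Hu Hv z Dz; have [? ? ? ?] := Hu z Dz; have [? ? ? ?] := Hv z Dz.
by split; [exact: is_deriveD|exact: is_deriveD|exact: cvgD|exact: cvgD].
Qed.

Lemma C1_withN u p q : C1_with D u p q ->
  C1_with D (fun z => - u z) (fun z => - p z) (fun z => - q z).
Proof.
move=> Hu z Dz; have [? ? ? ?] := Hu z Dz.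
by split; [exact: is_deriveN|exact: is_deriveN|exact: cvgN|exact: cvgN].
Qed.

Lemma C1_withB u p q v r s : C1_with D u p q -> C1_with D v r s ->
  C1_with D (fun z => u z - v z) (fun z => p z - r z) (fun z => q z - s z).
Proof. by move=> Hu Hv; exact: C1_withD Hu (C1_withN Hv). Qed.

Lemma C1_withM u p q v r s : C1_with D u p q -> C1_with D v r s ->
  C1_with D (fun z => u z * v z) (fun z => u z * r z + v z * p z)
    (fun z => u z * s z + v z * q z).
Proof.
move=> Hu Hv z Dz; have [? ? ? ?] := Hu z Dz; have [? ? ? ?] := Hv z Dz.
have cu := C1_with_continuous Hu Dz; have cv := C1_with_continuous Hv Dz.
split; [exact: is_deriveM|exact: is_deriveM| |].
- by apply: cvgD; exact: cvgM.
- by apply: cvgD; exact: cvgM.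
Qed.

Lemma C1_withZ (k : R) u p q : C1_with D u p q ->
  C1_with D (fun z => k * u z) (fun z => k * p z) (fun z => k * q z).
Proof.
move=> Hu; apply: C1_with_eq (C1_withM (C1_with_cst k) Hu) => z _.
by split; rewrite // mulr0 addr0.
Qed.

Lemma C1_withV u p q : (forall z, D z -> u z != 0) -> C1_with D u p q ->
  C1_with D (fun z => (u z)^-1) (fun z => - (u z) ^- 2 * p z)
    (fun z => - (u z) ^- 2 * q z).
Proof.
move=> u0 Hu z Dz; have [[du1 e1] [du2 e2] c1 c2] := Hu z Dz.
have cu := C1_with_continuous Hu Dz.
have cV : {for z, continuous (fun w => - (u w) ^- 2)}.
  by apply: cvgN; apply: cvgV; [rewrite expf_neq0// u0|apply: cvgM].
split.
- split; first exact: (@derivableV _ _ _ _ _ (u0 _ Dz) du1).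
  by rewrite (@deriveV _ _ _ _ _ (u0 _ Dz) du1) e1.
- split; first exact: (@derivableV _ _ _ _ _ (u0 _ Dz) du2).
  by rewrite (@deriveV _ _ _ _ _ (u0 _ Dz) du2) e2.
- exact: cvgM.
- exact: cvgM.
Qed.

Lemma C1_with_plane_form (a b : R) :
  C1_with D (plane_form a b) (fun=> a) (fun=> b).
Proof.
have cdf := @continuous_plane_form R a b.
have dl z : differentiable (plane_form a b : R * R -> R) z.
  exact: linear_differentiable.
move=> z Dz; split; try exact: cvg_cst.
- split; first exact: diff_derivable.
  by rewrite deriveE// diff_lin// -[LHS]/(1 * a + 0 * b) mul1r mul0r addr0.
- split; first exact: diff_derivable.
  by rewrite deriveE// diff_lin// -[LHS]/(0 * a + 1 * b) mul1r mul0r add0r.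
Qed.

End C1_calculus.

Definition bar (R : realType) (z : R * R) : R * R := (z.1, - z.2).

Lemma barK (R : realType) : involutive (@bar R).
Proof. by case=> x y; rewrite /bar/= opprK. Qed.

Lemma continuous_bar (R : realType) : continuous (@bar R).
Proof.
move=> z.
apply: (@cvg_pair _ _ _ (nbhs z) (nbhs z.1) (nbhs (- z.2)) _ _ _ fst
  (fun w : R * R => - w.2)); first exact: cvg_fst.
by apply: cvgN; exact: cvg_snd.
Qed.

Lemma C1_with_bar (R : realType) (D : set (R * R)) (u p q : R * R -> R) :
  open D -> (forall z, D z -> D (bar z)) -> C1_with D u p q ->
  C1_with D (u \o @bar R) (p \o @bar R) (fun z => - q (bar z)).
Proof.
move=> oD sD H z Dz; have [_ _ c1 c2] := H _ (sD _ Dz).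
have cb : {for z, continuous (@bar R)} by exact: continuous_bar.
have [du dE] := C1_with_diff oD H (sD _ Dz).
have E (v : R * R) : is_derive z v (u \o @bar R)
    (plane_form (p (bar z)) (q (bar z)) (bar v)).
  have Eh (h : R) : (u \o @bar R) (h *: v + z) = u (h *: bar v + bar z).
    have Eb : - (h * v.2 + z.2) = h * - v.2 - z.2 by ring.
    exact: (congr1 (fun s => u (h * v.1 + z.1, s)) Eb).
  have F : (fun h : R => h^-1 *: (((u \o @bar R) \o shift z) (h *: v) - u (bar z))) =
     (fun h : R => h^-1 *: ((u \o shift (bar z)) (h *: bar v) - u (bar z))).
    by apply/funext => h; congr (_ *: (_ - _)); exact: Eh.
  split; rewrite /derivable /derive F.
  - exact: diff_derivable.
  - by rewrite -[LHS]/('D_(bar v) u (bar z)) deriveE// dE.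
split.
- by move: (E (1, 0)); rewrite /plane_form/= oppr0 mul1r mul0r addr0.
- by move: (E (0, 1)); rewrite /plane_form/= mul0r add0r mulN1r.
- exact: continuous_comp.
- by apply: cvgN; exact: continuous_comp.
Qed.

(** * Holomorphic functions *)

(** Serves two purposes: gluing a function with 0 in the connectedness arguments, and normalizing
    functions off their domain. *)
Definition restrict0 (T : Type) (V : nmodType) (A : set T) (f : T -> V) (z : T) : V :=
  if `[<A z>] then f z else 0.

(** Only the third case is not local. There the cut functions are dominated in absolute value by the
    original ones, which vanish at [z]; continuity and a zero derivative follow by comparison. *)
Lemma C1_with_restrict0 (R : realType) (D A : set (R * R))
    (u p q : R * R -> R) :
  open D -> C1_with D u p q ->
  (forall z, D z -> [\/ (\forall w \near z, A w), (\forall w \near z, ~ A w) |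
    [/\ u z = 0, p z = 0 & q z = 0]]) ->
  C1_with D (restrict0 A u) (restrict0 A p) (restrict0 A q).
Proof.
move=> oD Hu HA z Dz; have [d1 d2 c1 c2] := Hu z Dz.
have in_A w (r : R * R -> R) : A w -> restrict0 A r w = r w.
  by move=> Aw; rewrite /restrict0 asboolT.
have out_A w (r : R * R -> R) : ~ A w -> restrict0 A r w = 0.
  by move=> Aw; rewrite /restrict0 asboolF.
have le_A w (r : R * R -> R) : `|restrict0 A r w| <= `|r w|.
  by rewrite /restrict0; case: ifP; rewrite ?normr0.
case: (HA z Dz) => [nA|nA|[uz pz qz]].
- have E (r : R * R -> R) : \forall w \near z, r w = restrict0 A r w.
    by near=> w; rewrite in_A//; near: w.
  rewrite ![restrict0 A _ z]in_A; try exact: nbhs_singleton nA.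
  split.
  + exact: near_eq_is_derive (E u) d1.
  + exact: near_eq_is_derive (E u) d2.
  + change (restrict0 A p @ z --> restrict0 A p z).
    rewrite -(nbhs_singleton (E p)); apply: cvg_trans c1.
    by apply: near_eq_cvg; exact: E.
  + change (restrict0 A q @ z --> restrict0 A q z).
    rewrite -(nbhs_singleton (E q)); apply: cvg_trans c2.
    by apply: near_eq_cvg; exact: E.
- have E (r : R * R -> R) : \forall w \near z, 0 = restrict0 A r w.
    by near=> w; rewrite out_A//; near: w.
  have cE (r : R * R -> R) : {for z, continuous (restrict0 A r)}.
    change (restrict0 A r @ z --> restrict0 A r z).
    rewrite -(nbhs_singleton (E r)).
    have c0 : (fun=> (0 : R)) @ z --> (0 : R) by exact: cvg_cst.
    by apply: cvg_trans c0; apply: near_eq_cvg; exact: E.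
  rewrite ![restrict0 A _ z]out_A; try exact: nbhs_singleton nA.
  split; [| |exact: cE|exact: cE].
  + by apply: (@near_eq_is_derive _ _ _ (fun=> 0) _ _ _ _ (E u)); exact: is_derive_cst.
  + by apply: (@near_eq_is_derive _ _ _ (fun=> 0) _ _ _ _ (E u)); exact: is_derive_cst.
have Z (r : R * R -> R) : r z = 0 -> restrict0 A r z = 0.
  by move=> rz; rewrite /restrict0 rz if_same.
have cE (r : R * R -> R) : r z = 0 -> {for z, continuous r} ->
    {for z, continuous (restrict0 A r)}.
  move=> rz cr; change (restrict0 A r @ z --> restrict0 A r z).
  rewrite Z//; apply/cvgrPdist_le => e e0.
  move/cvgrPdist_le : cr => /(_ e e0); rewrite rz.
  apply: filterS => w; rewrite !sub0r !normrN; exact: le_trans.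
have dE (v : R * R) : is_derive z v u 0 -> is_derive z v (restrict0 A u) 0.
  move=> [du du0].
  have : (fun h : R => h^-1 *: ((restrict0 A u \o shift z) (h *: v) -
      restrict0 A u z)) @ 0^' --> (0 : R).
    have : (fun h : R => h^-1 *: ((u \o shift z) (h *: v) - u z)) @ 0^' --> (0 : R).
      by rewrite -[X in _ --> X]du0; exact: du.
    move=> /cvgrPdist_le H; apply/cvgrPdist_le => e /H.
    apply: filterS => h; rewrite Z// uz !subr0 !sub0r !normrN !normrM.
    move=> he; apply: le_trans he; apply: ler_wpM2l => //; exact: le_A.
  move=> H; split; first by apply/cvg_ex; exists 0.
  exact: (cvg_lim (@Rhausdorff R) H).
rewrite !Z//; split; [| |exact: cE|exact: cE].
- by rewrite pz in d1; exact: dE.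
- by rewrite qz in d2; exact: dE.
Unshelve. all: by end_near. Qed.

Section complex_parts.
Context {R : realType}.
Implicit Types (c d : R[i]).

Lemma Re_addc c d : Re (c + d) = Re c + Re d. Proof. by case: c d => [? ?] []. Qed.
Lemma Im_addc c d : Im (c + d) = Im c + Im d. Proof. by case: c d => [? ?] []. Qed.
Lemma Re_oppc c : Re (- c) = - Re c. Proof. by case: c. Qed.
Lemma Im_oppc c : Im (- c) = - Im c. Proof. by case: c. Qed.
Lemma Re_mulc c d : Re (c * d) = Re c * Re d - Im c * Im d.
Proof. by case: c d => [? ?] []. Qed.
Lemma Im_mulc c d : Im (c * d) = Re c * Im d + Im c * Re d.
Proof. by case: c d => [? ?] []. Qed.
Lemma Re_invc c : Re c^-1 = Re c * (Re c * Re c + Im c * Im c)^-1.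
Proof. by case: c. Qed.
Lemma Im_invc c : Im c^-1 = - (Im c * (Re c * Re c + Im c * Im c)^-1).
Proof. by case: c. Qed.

Lemma complex_ext c d : Re c = Re d -> Im c = Im d -> c = d.
Proof. by case: c d => [? ?] [? ?] /= -> ->. Qed.

Lemma sqr_norm_neq0 c : c != 0 -> Re c * Re c + Im c * Im c != 0.
Proof.
apply: contra_neq => h; apply: complex_ext => /=; nra.
Qed.

End complex_parts.

(* [d] is the complex derivative of [c]; its two occurrences encode the
   Cauchy-Riemann equations. *)
Definition hol_with (R : realType) (D : set (R * R)) (c d : R * R -> R[i]) :=
  C1_with D (fun z => Re (c z)) (fun z => Re (d z)) (fun z => - Im (d z)) /\
  C1_with D (fun z => Im (c z)) (fun z => Im (d z)) (fun z => Re (d z)).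

Definition hol (R : realType) (D : set (R * R)) (c : R * R -> R[i]) :=
  exists d, hol_with D c d.

Section hol_calculus.
Context {R : realType} (D : set (R * R)).
Hypothesis oD : open D.
Implicit Types c d : R * R -> R[i].

Lemma hol_eq c d : (forall z, D z -> c z = d z) -> hol D c -> hol D d.
Proof.
move=> E [c' [H1 H2]]; exists c'; split.
- by apply: (C1_with_eq oD _ H1) => z Dz; rewrite E.
- by apply: (C1_with_eq oD _ H2) => z Dz; rewrite E.
Qed.

Lemma hol_cst (k : R[i]) : hol D (fun=> k).
Proof.
exists (fun=> 0); split; last exact: C1_with_cst.
by apply: (C1_with_eq oD _ (C1_with_cst (Re k))) => z _; rewrite oppr0.
Qed.

Lemma hol_withN c c' : hol_with D c c' ->
  hol_with D (fun z => - c z) (fun z => - c' z).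
Proof.
move=> [H1 H2]; split.
- by apply: (C1_with_eq oD _ (C1_withN H1)) => z _; rewrite !Re_oppc !Im_oppc.
- by apply: (C1_with_eq oD _ (C1_withN H2)) => z _; rewrite !Re_oppc !Im_oppc.
Qed.

Lemma hol_withD c c' d d' : hol_with D c c' -> hol_with D d d' ->
  hol_with D (fun z => c z + d z) (fun z => c' z + d' z).
Proof.
move=> [H1 H2] [H3 H4]; split.
- apply: (C1_with_eq oD _ (C1_withD H1 H3)) => z _.
  by rewrite !Re_addc !Im_addc opprD.
- by apply: (C1_with_eq oD _ (C1_withD H2 H4)) => z _; rewrite !Re_addc !Im_addc.
Qed.

Lemma hol_withM c c' d d' : hol_with D c c' -> hol_with D d d' ->
  hol_with D (fun z => c z * d z) (fun z => c z * d' z + d z * c' z).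
Proof.
move=> [H1 H2] [H3 H4]; split.
- apply: (C1_with_eq oD _ (C1_withB (C1_withM oD H1 H3) (C1_withM oD H2 H4))).
  by move=> z _; rewrite !(Re_addc, Im_addc, Re_mulc, Im_mulc); split; ring.
- apply: (C1_with_eq oD _ (C1_withD (C1_withM oD H1 H4) (C1_withM oD H2 H3))).
  by move=> z _; rewrite !(Re_addc, Im_addc, Re_mulc, Im_mulc); split; ring.
Qed.

Lemma holN c : hol D c -> hol D (fun z => - c z).
Proof. by move=> [c' /hol_withN]; exists (fun z => - c' z). Qed.

Lemma holD c d : hol D c -> hol D d -> hol D (fun z => c z + d z).
Proof. by move=> [c' Hc] [d' Hd]; eexists; exact: hol_withD Hc Hd. Qed.

Lemma holB c d : hol D c -> hol D d -> hol D (fun z => c z - d z).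
Proof. by move=> Hc Hd; exact: holD Hc (holN Hd). Qed.

Lemma holM c d : hol D c -> hol D d -> hol D (fun z => c z * d z).
Proof. by move=> [c' Hc] [d' Hd]; eexists; exact: hol_withM Hc Hd. Qed.

Lemma holX c n : hol D c -> hol D (fun z => c z ^+ n).
Proof.
move=> Hc; elim: n => [|n IHn]; first by apply: hol_eq (hol_cst 1) => z; rewrite expr0.
by apply: hol_eq (holM Hc IHn) => z _; rewrite exprS.
Qed.

Lemma holV c : (forall z, D z -> c z != 0) -> hol D c ->
  hol D (fun z => (c z)^-1).
Proof.
move=> c0 [c' [H1 H2]].
have HN := C1_withD (C1_withM oD H1 H1) (C1_withM oD H2 H2).
have N0 z : D z -> Re (c z) * Re (c z) + Im (c z) * Im (c z) != 0.
  by move=> /c0 /sqr_norm_neq0.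
have HV := C1_withV oD N0 HN.
exists (fun z => - c' z * ((c z)^-1 * (c z)^-1)); split.
- apply: (C1_with_eq oD _ (C1_withM oD H1 HV)) => z Dz.
  have := N0 z Dz; rewrite !(Re_mulc, Im_mulc, Re_invc, Im_invc, Re_oppc, Im_oppc).
  by move: (Re _) (Im _) (Re _) (Im _) => a b a' b' n0; split => //; field.
- apply: (C1_with_eq oD _ (C1_withN (C1_withM oD H2 HV))) => z Dz.
  have := N0 z Dz; rewrite !(Re_mulc, Im_mulc, Re_invc, Im_invc, Re_oppc, Im_oppc).
  by move: (Re _) (Im _) (Re _) (Im _) => a b a' b' n0; split => //; field.
Qed.

Lemma hol_affine (w : R * R) : hol D (fun z => (z.1 - w.1) +i* (z.2 - w.2))%C.
Proof.
exists (fun=> 1); split.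
- apply: (C1_with_eq oD _ (C1_withB (@C1_with_plane_form R D 1 0) (C1_with_cst w.1))).
  by move=> z _; rewrite /plane_form mulr1 mulr0 !subr0 addr0 oppr0.
- apply: (C1_with_eq oD _ (C1_withB (@C1_with_plane_form R D 0 1) (C1_with_cst w.2))).
  by move=> z _; rewrite /plane_form mulr1 mulr0 !subr0 add0r.
Qed.

(** Schwarz reflection: the conjugations of source and target each reverse the sign in the
    Cauchy-Riemann equations. *)
Lemma hol_bar c : (forall z, D z -> D (bar z)) -> hol D c ->
  hol D (fun z => conjc (c (bar z))).
Proof.
move=> sD [c' [H1 H2]]; exists (fun z => conjc (c' (bar z))); split.
- apply: (C1_with_eq oD _ (C1_with_bar oD sD H1)) => z _ /=.
  by case: (c _) (c' _) => [a b] [a' b'] /=; rewrite opprK.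
- apply: (C1_with_eq oD _ (C1_withN (C1_with_bar oD sD H2))) => z _ /=.
  by case: (c _) (c' _) => [a b] [a' b'] /=; rewrite opprK.
Qed.

Lemma hol_restrict0 (A : set (R * R)) c c' : hol_with D c c' ->
  (forall z, D z -> [\/ (\forall w \near z, A w), (\forall w \near z, ~ A w) |
    c z = 0 /\ c' z = 0]) ->
  hol D (restrict0 A c).
Proof.
move=> [H1 H2] HA; exists (restrict0 A c'); split.
- apply: (C1_with_eq oD _ (C1_with_restrict0 (A := A) oD H1 _)) => z Dz.
    by rewrite /restrict0; case: ifP; rewrite // oppr0.
  case: (HA z Dz) => [?|?|[-> ->]]; [exact: Or31|exact: Or32|].
  by apply: Or33; rewrite oppr0.
- apply: (C1_with_eq oD _ (C1_with_restrict0 (A := A) oD H2 _)) => z Dz.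
    by rewrite /restrict0; case: ifP.
  by case: (HA z Dz) => [?|?|[-> ->]]; [exact: Or31|exact: Or32|exact: Or33].
Qed.

Lemma hol_continuous c z : hol D c -> D z ->
  {for z, continuous (fun w => Re (c w))} /\
  {for z, continuous (fun w => Im (c w))}.
Proof.
move=> [c' [H1 H2]] Dz; split; first exact: (C1_with_continuous oD H1 Dz).
exact: (C1_with_continuous oD H2 Dz).
Qed.

Lemma hol_near_neq0 c z : hol D c -> D z -> c z != 0 ->
  \forall w \near z, c w != 0.
Proof.
move=> Hc Dz; have [cr ci] := hol_continuous Hc Dz.
rewrite eq_complex negb_and => /orP[h|h].
- have : \forall w \near z, Re (c w) != 0.
    by move/cvgr_neq0 : cr; apply.
  by apply: filterS => w; apply: contra => /eqP ->.
- have : \forall w \near z, Im (c w) != 0.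
    by move/cvgr_neq0 : ci; apply.
  by apply: filterS => w; apply: contra => /eqP ->.
Qed.

Lemma open_hol_neq0 c : hol D c -> open (D `&` [set z | c z != 0]).
Proof.
move=> Hc; rewrite openE => z [Dz cz].
by apply: filterI; [exact: open_nbhs_nbhs|exact: hol_near_neq0].
Qed.

End hol_calculus.

Lemma hol_sub (R : realType) (D D' : set (R * R)) c :
  D' `<=` D -> hol D c -> hol D' c.
Proof. by move=> sD [d [H1 H2]]; exists d; split=> z /sD; [exact: H1|exact: H2]. Qed.

(** * The mean value inequality *)

(** Uniform continuity in near-covering form: the filter of small positive radii is pushed through
    the compact set, and halving the local radius lets one ball contain both points compared. *)
Lemma compact_uniform (R : realType) (K : set (R * R)) (X : R * R -> R)
    (e : R) : compact K -> (forall z, K z -> {for z, continuous X}) -> 0 < e ->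
  exists2 d : R, 0 < d & forall z w, K z -> ball z d w -> `|X z - X w| <= e.
Proof.
move=> /compact_near_coveringP cK cX e0.
have := cK R (0^'+ : set_system R)
  (fun d z => forall w, ball z d w -> `|X z - X w| <= e) _.
case=> [|d /= d0 H].
  move=> z Kz; have e20 : 0 < e / 2 by rewrite divr_gt0.
  have /cvgrPdist_le/(_ _ e20)/nbhs_ballP[d /= d0 dH] := cX z Kz.
  exists (ball z (d / 2), [set s | s < d / 2]).
    split => /=; first by apply: nbhsx_ballx; rewrite divr_gt0.
    by apply: nbhs_right_lt; rewrite divr_gt0.
  move=> [z' s] /= [zz' sd] w z'w.
  have h1 := dH z' (le_ball _ zz').
  have zw : ball z d w.
    by rewrite (splitr d); apply: ball_triangle zz' (le_ball (ltW sd) z'w).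
  have h2 := dH _ zw.
  rewrite -(subrKA (X z)) (splitr e); apply: le_trans (ler_normD _ _) _.
  rewrite lerD// distrC h1// ler_pdivrMr// ler_pMr// ler1n//.
have d20 : 0 < d / 2 by rewrite divr_gt0.
exists (d / 2) => // z w Kz; apply: (H (d / 2)) => //.
by rewrite /ball/= sub0r normrN gtr0_norm// ltr_pdivrMr// ltr_pMr// ltr1n.
Qed.

Lemma compact_bound (R : realType) (K : set (R * R)) (X : R * R -> R) :
  compact K -> (forall z, K z -> {for z, continuous X}) ->
  exists M, forall z, K z -> `|X z| <= M.
Proof.
move=> /compact_near_coveringP cK cX.
have [|M [_ H]] := cK R (+oo%R : set_system R) (fun M z => `|X z| <= M) _.
  move=> z Kz.
  have /cvgrPdist_le/(_ _ ltr01) dH := cX z Kz.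
  exists ([set w | `|X z - X w| <= 1], [set s | `|X z| + 1 <= s]).
    by split => //=; apply: nbhs_pinfty_ge; exact: num_real.
  move=> [w s] /= [h1 h2]; apply: le_trans h2.
  by rewrite -[X w](subKr (X z)); apply: le_trans (ler_normB _ _) _; rewrite lerD2l.
by exists (M + 1) => z; apply: H; rewrite ltrDl.
Qed.

Lemma is_derive_path (R : realType) (u : R * R -> R) (a b p q : R)
    (x y : R -> R) (t : R) :
  is_derive t 1 x a -> is_derive t 1 y b ->
  is_diff (x t, y t) u (plane_form p q) ->
  is_derive t 1 (fun s => u (x s, y s)) (a * p + b * q).
Proof.
move=> [dx ex] [dy ey] du.
have Dx : is_diff t x ('d x t).
  by apply: differentiableP; apply/derivable1_diffP; exact: dx.
have Dy : is_diff t y ('d y t).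
  by apply: differentiableP; apply/derivable1_diffP; exact: dy.
have Dxy := is_diff_pair Dx Dy.
have [D E] := @is_diff_comp _ _ _ _ _ _ _ _ _ Dxy du.
split; first exact/derivable1_diffP.
rewrite -[X in 'D_1 X t]/(u \o (fun s => (x s, y s))) deriveE// E.
by rewrite -ex -ey !deriveE//; exact/derivable1_diffP.
Qed.

Lemma is_derive_affine (R : realType) (f : R -> R) (df a k t : R) :
  is_derive t 1 f df -> is_derive t 1 (fun s => a + k * f s) (k * df).
Proof.
move=> Hf; have H := is_deriveD (is_derive_cst a t 1) (is_deriveZ k Hf).
by apply: is_derive_eq H _; rewrite add0r.
Qed.

Section mean_value.
Context {R : realType} (D : set (R * R)) (u v p q : R * R -> R).
Hypotheses (oD : open D) (Hu : C1_with D u p q)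
  (Hv : C1_with D v (fun z => - q z) p).
Variables (a b r : R).
Hypotheses (r0 : 0 < r)
  (disc : forall z, (z.1 - a) ^+ 2 + (z.2 - b) ^+ 2 <= r ^+ 2 -> D z).

Let pt (t th : R) := (a + t * cos th, b + t * sin th).
(** The Cauchy-Riemann equations in polar coordinates about [(a, b)]: [X w] is the radial derivative
    of [u], and [w.1 * X w] is the angular derivative of its conjugate [v]. *)
Let X (w : R * R) := cos w.2 * p (pt w.1 w.2) + sin w.2 * q (pt w.1 w.2).

Let D_pt t th : 0 <= t <= r -> D (pt t th).
Proof.
move=> /andP[t0 tr]; apply: disc => /=.
have -> : (a + t * cos th - a) ^+ 2 + (b + t * sin th - b) ^+ 2 =
  t ^+ 2 * (cos th ^+ 2 + sin th ^+ 2) by ring.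
by rewrite cos2Dsin2 mulr1 lerXn2r// nnegrE// ltW.
Qed.

Let derive_radial (t th : R) : 0 <= t <= r ->
  is_derive t 1 (fun s => u (pt s th)) (X (t, th)).
Proof.
move=> ht; have E (k c : R) : is_derive t 1 (fun s => k + s * c) c.
  have := is_derive_affine k c (is_derive_id t 1); rewrite mulr1.
  by congr is_derive; apply/funext => s; rewrite mulrC.
exact: (is_derive_path (E a (cos th)) (E b (sin th))
  (C1_with_diff oD Hu (D_pt th ht))).
Qed.

Let derive_angular (t th : R) : 0 <= t <= r ->
  is_derive th 1 (fun s => v (pt t s)) (t * X (t, th)).
Proof.
move=> ht; have -> : t * X (t, th) =
    (- (t * sin th)) * (- q (pt t th)) + (t * cos th) * p (pt t th).
  by rewrite /X/=; ring.
rewrite -mulrN.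
exact: (is_derive_path (is_derive_affine a t (is_derive_cos th))
  (is_derive_affine b t (is_derive_sin th)) (C1_with_diff oD Hv (D_pt th ht))).
Qed.

Let continuous_X w : 0 <= w.1 <= r -> {for w, continuous X}.
Proof.
move=> hw; have [_ _ cp cq] := Hu (D_pt w.2 hw).
have c1 : {for w, continuous (fun w : R * R => cos w.2)}.
  apply: (@continuous_comp _ _ _ snd (@cos R)); last exact: continuous_cos.
  exact: cvg_snd.
have c2 : {for w, continuous (fun w : R * R => sin w.2)}.
  apply: (@continuous_comp _ _ _ snd (@sin R)); last exact: continuous_sin.
  exact: cvg_snd.
have cpt : {for w, continuous (fun w => pt w.1 w.2)}.
  apply: (@cvg_pair _ _ _ (nbhs w) (nbhs _) (nbhs _) _ _ _
    (fun w : R * R => a + w.1 * cos w.2) (fun w : R * R => b + w.1 * sin w.2)).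
  - by apply: cvgD; [exact: cvg_cst|apply: cvgM => //; exact: cvg_fst].
  - by apply: cvgD; [exact: cvg_cst|apply: cvgM => //; exact: cvg_fst].
apply: cvgD; apply: cvgM => //.
- exact: (@continuous_comp _ _ _ (fun w => pt w.1 w.2) p).
- exact: (@continuous_comp _ _ _ (fun w => pt w.1 w.2) q).
Qed.

Let th (n k : nat) : R := pi *+ 2 / n.+1%:R * k%:R.

Let thS n k : th n k.+1 - th n k = pi *+ 2 / n.+1%:R.
Proof. by rewrite /th -mulrBr -natrB// subSnn mulr1. Qed.

Let th_itv n k : (k <= n.+1)%N -> 0 <= th n k <= pi *+ 2.
Proof.
move=> kn; have p0 : 0 <= pi *+ 2 :> R by rewrite mulrn_wge0// pi_ge0.
rewrite /th mulr_ge0 ?divr_ge0//=.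
by rewrite mulrAC -mulrA ler_piMr// ler_pdivrMr// mul1r ler_nat.
Qed.

(* The increments of [v] along the circle telescope to 0, and each of them is
   [t * X] at an intermediate point times the common angle. *)
Let sum_angular n (t : R) : 0 < t <= r ->
  exists s : nat -> R, (forall k, (k < n.+1)%N -> s k \in `[th n k, th n k.+1]) /\
    \sum_(k < n.+1) X (t, s k) = 0.
Proof.
move=> /andP[t0 tr]; have ht : 0 <= t <= r by rewrite ltW.
have h0 : 0 < pi *+ 2 / n.+1%:R :> R by rewrite divr_gt0// mulrn_wgt0// pi_gt0.
have H k : exists s, s \in `[th n k, th n k.+1] /\
    v (pt t (th n k.+1)) - v (pt t (th n k)) =
    t * X (t, s) * (pi *+ 2 / n.+1%:R).
  have le : th n k <= th n k.+1 by rewrite -subr_ge0 thS ltW.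
  have [||s sk E] := @MVT_segment R (fun s => v (pt t s)) (fun s => t * X (t, s))
    _ _ le.
  - by move=> s _; exact: derive_angular.
  - apply: continuous_subspaceT => s.
    have [ds _] := derive_angular s ht.
    by apply/differentiable_continuous/derivable1_diffP.
  by exists s; rewrite E thS.
have [s Hs] := choice H; exists s; split; first by move=> k _; have [] := Hs k.
have : \sum_(k < n.+1) (v (pt t (th n k.+1)) - v (pt t (th n k))) = 0.
  rewrite -(big_mkord xpredT (fun k => v (pt t (th n k.+1)) - v (pt t (th n k)))).
  rewrite telescope_sumr// /pt /th mulr0 cos0 sin0 divfK ?pnatr_eq0//.
  by rewrite cos2pi sin2pi subrr.
under eq_bigr => k _ do rewrite (Hs k).2.
rewrite -mulr_suml -mulr_sumr => /eqP.
by rewrite mulf_eq0 (gt_eqF h0) orbF mulf_eq0 (gt_eqF t0) /= => /eqP.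
Qed.

(** The sum [A t] of [u] over [n.+1] equally spaced points of the circle of radius [t] has the sum
    of [X] over them as derivative. By [sum_angular] the same sum at nearby angles is 0, so uniform
    continuity of [X] makes this derivative small, and [A r] is close to [A 0], which is [n.+1]
    times the value at the centre. *)
Lemma mean_value_ineq (M : R) :
  (forall z, (z.1 - a) ^+ 2 + (z.2 - b) ^+ 2 = r ^+ 2 -> `|u z| <= M) ->
  `|u (a, b)| <= M.
Proof.
move=> HM; apply/ler_addgt0Pr => e e0.
(* The increment of [A] over [[0, r]] multiplies the bound on its derivative by [r]. *)
have er : 0 < e / r by rewrite divr_gt0.
have cK : compact (`[0, r] `*` `[0, pi *+ 2] : set (R * R)).
  by apply: compact_setX; exact: segment_compact.
have [|d d0 Hd] := compact_uniform (X := X) cK _ er.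
  by move=> w [/= /[!in_itv]/= + _]; exact: continuous_X.
have [n hn] : exists n : nat, pi *+ 2 / n.+1%:R < d.
  exists (Num.truncn (pi *+ 2 / d)); rewrite ltr_pdivrMr// mulrC -ltr_pdivrMr//.
  exact: truncnS_gt.
pose A (t : R) := \sum_(k < n.+1) u (pt t (th n k)).
pose dA (t : R) := \sum_(k < n.+1) X (t, th n k).
have HA (t : R) : 0 <= t <= r -> is_derive t 1 A (dA t).
  move=> ht.
  have -> : A = \sum_(k < n.+1) (fun t => u (pt t (th n k))).
    by apply/funext => s; rewrite fct_sumE.
  by apply: is_derive_sum => k; exact: derive_radial.
(* The intermediate [t] is interior, hence positive: at [t = 0] the angular increments are all 0 and
   say nothing about [X]. *)
have [||t] := @MVT R A dA 0 r r0.
- by move=> t; rewrite in_itv/= => /andP[t0 tr]; apply: HA; rewrite !ltW.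
- apply: derivable_within_continuous => t; rewrite in_itv/= => ht.
  by have [] := HA t ht.
rewrite in_itv/= subr0 => /andP[t0 tr] E.
have hAr : `|A r| <= n.+1%:R * M.
  apply: le_trans (ler_norm_sum _ _ _) _.
  rewrite -[X in X%:R](card_ord n.+1) -sum1_card natr_sum mulr_suml.
  apply: ler_sum => k _; rewrite mul1r; apply: HM => /=.
  have -> : (a + r * cos (th n k) - a) ^+ 2 + (b + r * sin (th n k) - b) ^+ 2 =
    r ^+ 2 * (cos (th n k) ^+ 2 + sin (th n k) ^+ 2) by ring.
  by rewrite cos2Dsin2 mulr1.
have A0 : A 0 = n.+1%:R * u (a, b).
  rewrite /A /pt; under eq_bigr => k _ do rewrite !mul0r !addr0.
  by rewrite sumr_const card_ord mulr_natl.
have hdA : `|dA t| <= n.+1%:R * (e / r).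
  have [|s [Hs Es]] := @sum_angular n t; first by rewrite t0 ltW.
  rewrite -[dA t]subr0 -[in X in _ - X]Es -sumrB.
  apply: le_trans (ler_norm_sum _ _ _) _.
  rewrite -[X in X%:R](card_ord n.+1) -sum1_card natr_sum mulr_suml.
  apply: ler_sum => k _; rewrite mul1r; apply: Hd.
    split; rewrite /= in_itv/=; first by rewrite !ltW.
    by apply: th_itv; rewrite ltnW// ltnS.
  split; first exact: ballxx.
  rewrite /ball/=; have := Hs k (ltn_ord k).
  rewrite in_itv/= => /andP[sk1 sk2]; rewrite distrC ger0_norm ?subr_ge0//.
  by apply: le_lt_trans hn; rewrite -(thS n k) lerD2r.
have n0 : 0 < n.+1%:R :> R by [].
rewrite -(ler_pM2l n0) -[X in X * `|_|](gtr0_norm n0) -normrM -A0.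
have -> : A 0 = A r - dA t * r by rewrite -E; ring.
apply: le_trans (ler_normB _ _) _; rewrite mulrDr; apply: lerD => //.
rewrite normrM (gtr0_norm r0) -ler_pdivlMr//.
by rewrite -mulrA.
Qed.

End mean_value.

Lemma hol_mean_ineq (R : realType) (D : set (R * R)) (c : R * R -> R[i])
    (z0 : R * R) (r M : R) : open D -> hol D c -> 0 < r ->
  (forall z, (z.1 - z0.1) ^+ 2 + (z.2 - z0.2) ^+ 2 <= r ^+ 2 -> D z) ->
  (forall z, (z.1 - z0.1) ^+ 2 + (z.2 - z0.2) ^+ 2 = r ^+ 2 ->
    `|Re (c z)| <= M /\ `|Im (c z)| <= M) ->
  `|Re (c z0)| <= M /\ `|Im (c z0)| <= M.
Proof.
case: z0 => a b oD [d [H1 H2]] r0 disc HM.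
have H2' : C1_with D (fun z => Im (c z)) (fun z => - (- Im (d z)))
    (fun z => Re (d z)).
  by apply: (C1_with_eq oD _ H2) => z _; rewrite opprK.
(* The conjugate of [Im c] is [- Re c], as multiplication of [c] by [-i] shows. *)
have H3 := C1_withN H1.
split.
- by apply: (mean_value_ineq oD H1 H2' r0 disc) => z /HM[].
- have H3' : C1_with D (fun z => - Re (c z)) (fun z => - Re (d z))
      (fun z => Im (d z)).
    by apply: (C1_with_eq oD _ H3) => z _; rewrite opprK.
  by apply: (mean_value_ineq oD H2 H3' r0 disc) => z /HM[].
Qed.

(** * Unique continuation *)

(** Euclidean, because the mean value inequality lives on round circles while the norm of [R * R] is
    the maximum; squared, to stay polynomial. *)
Definition dist2 (R : realType) (z w : R * R) : R :=
  (z.1 - w.1) ^+ 2 + (z.2 - w.2) ^+ 2.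

Definition box (R : realType) (w : R * R) (r : R) : set (R * R) :=
  `[w.1 - r, w.1 + r] `*` `[w.2 - r, w.2 + r].

Definition nsq (R : realType) (c : R[i]) : R :=
  Re c * Re c + Im c * Im c.

Section unique_continuation.
Context {R : realType}.
Implicit Types (z w : R * R) (r s : R).

Lemma boxP w r z : box w r z <-> `|z.1 - w.1| <= r /\ `|z.2 - w.2| <= r.
Proof.
by rewrite !ler_distl /box; split => -[] /=; rewrite !in_itv/=.
Qed.

Lemma dist2_coord z w r : 0 <= r -> dist2 z w <= r ^+ 2 ->
  `|z.1 - w.1| <= r /\ `|z.2 - w.2| <= r.
Proof.
rewrite /dist2; move: (z.1 - w.1) (z.2 - w.2) => x y r0 H.
by split; rewrite -ler_sqr ?nnegrE// real_normK ?num_real//; nra.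
Qed.

Lemma nsqM (c d : R[i]) : nsq (c * d) = nsq c * nsq d.
Proof. by rewrite /nsq Re_mulc Im_mulc; ring. Qed.

Lemma nsqX (c : R[i]) n : nsq (c ^+ n) = nsq c ^+ n.
Proof.
elim: n => [|n IH]; first by rewrite /nsq !expr0 /=; ring.
by rewrite !exprS nsqM IH.
Qed.

Lemma nsq_ge0 (c : R[i]) : 0 <= nsq c.
Proof. by rewrite addr_ge0// -expr2 sqr_ge0. Qed.

Lemma nsqV (c : R[i]) : c != 0 -> nsq c^-1 = (nsq c)^-1.
Proof.
move=> c0; have n0 := sqr_norm_neq0 c0; apply: (mulfI n0).
rewrite mulfV// -[LHS]/(nsq c * nsq c^-1) -nsqM mulfV//.
by rewrite /nsq /=; ring.
Qed.

Lemma norm_le_sqrt_nsq (c : R[i]) (B : R) : nsq c <= B ->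
  `|Re c| <= Num.sqrt B /\ `|Im c| <= Num.sqrt B.
Proof.
move=> H; rewrite -!sqrtr_sqr; split; apply: ler_wsqrtr;
  apply: le_trans H; rewrite /nsq; nra.
Qed.

Lemma le_geometric_le0 (x C k : R) : 0 <= k < 1 ->
  (forall n, x <= C * k ^+ n) -> x <= 0.
Proof.
move=> /andP[k0 k1] H; rewrite leNgt; apply/negP => x0.
have cv : (fun n => C * k ^+ n) @ \oo --> C * 0.
  by apply: cvgM; [exact: cvg_cst|apply: cvg_expr; rewrite ger0_norm].
rewrite mulr0 in cv; move/cvgrPdist_lt : cv => /(_ _ x0)[N _ HN].
have := HN N (leqnn N); rewrite /= sub0r normrN => h.
by have := le_lt_trans (le_trans (H N) (ler_norm _)) h; rewrite ltxx.
Qed.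

Variables (D : set (R * R)) (c : R * R -> R[i]).
Hypotheses (oD : open D) (Hc : hol D c).

(* For [w'] the midpoint of [w] and [z], the mean value inequality on the circle
   of radius [s / 4] about [z] is applied to [c x * ((z - w') / (x - w')) ^+ n].
   On that circle, at points [x] outside the disc where [c] is known to vanish,
   the quotient has square modulus at most [99 / 100], thanks to the factor
   [41 / 40]. *)
Lemma zero_disc_grow w (s rho : R) : 0 < s -> s <= 2 * rho ->
  box w (3 * rho) `<=` D ->
  (forall z, dist2 z w <= s ^+ 2 -> c z = 0) ->
  forall z, dist2 z w <= (41 / 40 * s) ^+ 2 -> dist2 z w <= (2 * rho) ^+ 2 ->
    c z = 0.
Proof.
move=> s0 srho boxD Z z zs zrho; have [/Z//|sz] := leP (dist2 z w) (s ^+ 2).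
have rho0 : 0 < rho by lra.
have [zw1 zw2] : `|z.1 - w.1| <= 2 * rho /\ `|z.2 - w.2| <= 2 * rho.
  by apply: dist2_coord => //; lra.
(* Since [s / 4 <= rho / 2] and each coordinate of [z] is within [2 * rho] of that of [w], the disc
   stays inside the box of half-side [3 * rho]. *)
have near_z x : dist2 x z <= (s / 4) ^+ 2 -> box w (3 * rho) x.
  move=> /dist2_coord[|h1 h2]; first lra.
  apply/boxP; split.
  - by rewrite -(subrKA z.1); apply: le_trans (ler_normD _ _) _; lra.
  - by rewrite -(subrKA z.2); apply: le_trans (ler_normD _ _) _; lra.
have cK : compact (box w (3 * rho)).
  by apply: compact_setX; exact: segment_compact.
have [M1 HM1] : exists M, forall x, box w (3 * rho) x -> `|Re (c x)| <= M.
  apply: compact_bound => // x /boxD Dx.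
  by have [] := hol_continuous oD Hc Dx.
have [M2 HM2] : exists M, forall x, box w (3 * rho) x -> `|Im (c x)| <= M.
  apply: compact_bound => // x /boxD Dx.
  by have [] := hol_continuous oD Hc Dx.
have HM x : box w (3 * rho) x -> nsq (c x) <= M1 ^+ 2 + M2 ^+ 2.
  move=> bx; rewrite /nsq -!expr2 lerD//.
  - rewrite -(real_normK (num_real (Re _))) lerXn2r// ?nnegrE ?HM1//.
    exact: le_trans (HM1 _ bx).
  - rewrite -(real_normK (num_real (Im _))) lerXn2r// ?nnegrE ?HM2//.
    exact: le_trans (HM2 _ bx).
pose w' : R * R := ((z.1 + w.1) / 2, (z.2 + w.2) / 2).
pose E (x : R * R) : R[i] := ((x.1 - w'.1) +i* (x.2 - w'.2))%C.
have HE U : open U -> hol U E by move=> oU; exact: hol_affine.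
(* The median formula in the triangle [x], [w], [z], whose side from [w] to [z] has midpoint
   [w']. *)
have nE x : nsq (E x) = dist2 x w / 2 - dist2 z w / 4 + dist2 x z / 2.
  by rewrite /nsq /E /dist2 /=; field.
have zz : dist2 z z = 0 by rewrite /dist2 !subrr; ring.
pose D' := D `&` [set x | E x != 0].
have oD' : open D' by apply: open_hol_neq0 => //; exact: HE.
have D'D : D' `<=` D by move=> x [].
have disc x : dist2 x z <= (s / 4) ^+ 2 -> D' x.
  move=> xz; split; first exact/boxD/near_z.
  apply/eqP => Ex0.
  have e1 : x.1 = w'.1.
    by apply/eqP; rewrite -subr_eq0; apply/eqP; exact: (congr1 (fun k => Re k) Ex0).
  have e2 : x.2 = w'.2.
    by apply/eqP; rewrite -subr_eq0; apply/eqP; exact: (congr1 (fun k => Im k) Ex0).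
  have : dist2 x z = dist2 z w / 4 by rewrite /dist2 e1 e2 /w' /=; field.
  move: xz sz; rewrite !exprMn !exprVn => xz sz e4; lra.
have Ez0 : E z != 0 by have [] : D' z by apply: disc; rewrite zz sqr_ge0.
pose f n x := c x * (E z * (E x)^-1) ^+ n.
have Hf n : hol D' (f n).
  apply: holM => //; first exact: hol_sub Hc.
  apply: holX => //; apply: holM => //; first exact: hol_cst.
  by apply: holV => //; [move=> x []|exact: HE].
have bound n x : dist2 x z = (s / 4) ^+ 2 ->
    nsq (f n x) <= (M1 ^+ 2 + M2 ^+ 2) * (99 / 100) ^+ n.
  move=> xz; have xz' : dist2 x z <= (s / 4) ^+ 2 by rewrite xz.
  have M0 : 0 <= M1 ^+ 2 + M2 ^+ 2 by rewrite addr_ge0 ?sqr_ge0.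
  rewrite /f nsqM nsqX; have [/Z->|sx] := leP (dist2 x w) (s ^+ 2).
    by rewrite {1}/nsq /= !mulr0 addr0 mul0r mulr_ge0// exprn_ge0//; lra.
  have [_ Ex0] := disc x xz'.
  rewrite ler_pM ?exprn_ge0 ?nsq_ge0 ?HM//; first exact: near_z.
  rewrite lerXn2r ?nnegrE ?nsq_ge0//.
  rewrite nsqM nsqV// ler_pdivrMr ?lt_def ?nsq_ge0 ?andbT; last exact: sqr_norm_neq0.
  (* In units of [s ^+ 2], the left side is at most 0.2627, while the right side is at least 0.99
     times 0.2685. *)
  rewrite !nE zz xz; move: zs sx sz; rewrite !exprMn !exprVn; lra.
have Hz n : `|Re (c z)| <= Num.sqrt ((M1 ^+ 2 + M2 ^+ 2) * (99 / 100) ^+ n) /\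
            `|Im (c z)| <= Num.sqrt ((M1 ^+ 2 + M2 ^+ 2) * (99 / 100) ^+ n).
  have -> : c z = f n z by rewrite /f mulfV// expr1n mulr1.
  apply: (hol_mean_ineq oD' (Hf n) (r := s / 4)); first by rewrite divr_gt0.
    exact: disc.
  by move=> x /bound /norm_le_sqrt_nsq.
have k1 : (0 : R) <= (99 / 100 : R) < 1 by lra.
have sq0 (x : R) : (forall n, `|x| <= Num.sqrt ((M1 ^+ 2 + M2 ^+ 2) * (99 / 100) ^+ n)) ->
    x = 0.
  move=> H; apply/eqP; rewrite -sqrf_eq0 eq_le sqr_ge0 andbT.
  apply: (le_geometric_le0 k1 (C := M1 ^+ 2 + M2 ^+ 2)) => n.
  have B0 : 0 <= (M1 ^+ 2 + M2 ^+ 2) * (99 / 100) ^+ n.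
    by rewrite mulr_ge0 ?addr_ge0 ?sqr_ge0// exprn_ge0//; lra.
  by rewrite -(sqr_sqrtr B0) -(real_normK (num_real x)) lerXn2r// ?nnegrE ?sqrtr_ge0.
by apply: complex_ext; apply: sq0 => n; have [] := Hz n.
Qed.

Lemma ler_sqr_pos (x y : R) : 0 < x -> x <= y -> x ^+ 2 <= y ^+ 2.
Proof. by move=> x0 xy; rewrite lerXn2r// nnegrE; lra. Qed.

(** The growth factor of [zero_disc_grow] does not depend on the radius, so finitely many steps
    reach [2 * rho]; the cap in [t] keeps every radius within the range of that lemma. *)
Lemma zero_disc_extend w (s rho : R) : 0 < s -> 0 < rho ->
  box w (3 * rho) `<=` D ->
  (forall z, dist2 z w <= s ^+ 2 -> c z = 0) ->
  forall z, dist2 z w <= (2 * rho) ^+ 2 -> c z = 0.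
Proof.
move=> s0 rho0 boxD Z.
pose t n := Num.min ((41 / 40) ^+ n * s) (2 * rho).
have q0 : (0 : R) < 41 / 40 by lra.
have t0 n : 0 < t n by rewrite lt_min !mulr_gt0 ?exprn_gt0.
have H n : forall z, dist2 z w <= t n ^+ 2 -> c z = 0.
  elim: n => [|n IH] z zt.
    apply: Z; apply: le_trans zt _; apply: ler_sqr_pos => //.
    by rewrite /t expr0 mul1r ge_min lexx.
  have tS : t n.+1 <= 41 / 40 * t n.
    rewrite /t exprS -mulrA ge_min; set A := _ ^+ n * s.
    by case: (leP A (2 * rho)) => _; rewrite ?lexx//; apply/orP; right; lra.
  apply: (zero_disc_grow (t0 n) _ boxD IH).
  - by rewrite /t ge_min lexx orbT.
  - by apply: le_trans zt _; exact: ler_sqr_pos.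
  - apply: le_trans zt _; apply: ler_sqr_pos => //.
    by rewrite /t ge_min lexx orbT.
have [n hn] : exists n, 2 * rho <= (41 / 40) ^+ n * s.
  have : (fun n => (41 / 40 : R)^-1 ^+ n) @ \oo --> (0 : R).
    by apply: cvg_expr; rewrite ger0_norm; lra.
  have sr : 0 < s / (2 * rho) by rewrite divr_gt0 ?mulr_gt0.
  move/cvgrPdist_lt => /(_ _ sr)[N _ HN]; exists N.
  have := HN N (leqnn N); rewrite /= sub0r normrN.
  have p0 : 0 < (41 / 40 : R) ^+ N by exact: exprn_gt0.
  rewrite exprVn gtr0_norm ?invr_gt0// => h; apply: ltW.
  move: h; rewrite ltr_pdivlMr ?mulr_gt0// [_^-1 * _]mulrC.
  by rewrite ltr_pdivrMr// [s * _]mulrC.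
by move=> z zr; apply: (H n); rewrite /t min_r.
Qed.

(** The interior of the zero set is nonempty and open; [zero_disc_extend] makes it closed in [D]. A
    point [w] of it close to a limit point [z] is the centre of a zero disc whose radius depends on
    the room around [z], not on the size of the initial disc at [w]. *)
Lemma hol_identity z0 : connected D -> D z0 ->
  (\forall z \near z0, c z = 0) -> forall z, D z -> c z = 0.
Proof.
move=> cD Dz0 Z0.
pose W := [set z | D z /\ \forall w \near z, c w = 0].
suff <- : W = D by move=> z [_ /nbhs_singleton].
apply: cD.
- by exists z0.
- exists [set z | c z = 0]°; first exact: open_interior.
  by rewrite eqEsubset; split=> z [Dz Zz].
- exists (closure W); first exact: closed_closure.
  rewrite eqEsubset; split=> z; first by move=> Wz; split; [case: Wz|exact: subset_closure].
  move=> [Dz clz]; split => //.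
  have /nbhs_ballP[e /= e0 eD] : nbhs z D by exact: open_nbhs_nbhs.
  (* With [w] within [rho / 2] of [z], the box of half-side [3 * rho] about [w] fits in the ball of
     radius [5 * rho] about [z], and the disc of radius [2 * rho] about [w] covers the ball of
     radius [rho / 2] about [z]. *)
  pose rho := e / 5; have rho0 : 0 < rho by rewrite divr_gt0.
  have rho20 : 0 < rho / 2 by rewrite divr_gt0.
  have [w [[Dw Zw] zw]] := clz _ (nbhsx_ballx z (rho / 2) rho20).
  have /nbhs_ballP[s /= s0 sZ] := Zw.
  have [zw1 zw2] : `|z.1 - w.1| < rho / 2 /\ `|z.2 - w.2| < rho / 2 by exact: zw.
  have H : forall x, dist2 x w <= (2 * rho) ^+ 2 -> c x = 0.
    apply: (@zero_disc_extend w (s / 2)) => //; first by rewrite divr_gt0.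
      move=> x /boxP[x1 x2]; apply: eD; split; rewrite /ball/=.
      - rewrite -(subrKA w.1); apply: le_lt_trans (ler_normD _ _) _.
        by rewrite (distrC w.1); rewrite /rho in x1 zw1; lra.
      - rewrite -(subrKA w.2); apply: le_lt_trans (ler_normD _ _) _.
        by rewrite (distrC w.2); rewrite /rho in x2 zw2; lra.
    move=> x xs; apply: sZ.
    have [|x1 x2] := dist2_coord _ xs; first by rewrite divr_ge0// ltW.
    by split; rewrite /ball/= distrC; lra.
  apply/nbhs_ballP; exists (rho / 2) => // x [/= x1 x2].
  apply: H; rewrite /ball/= in x1 x2.
  have : `|x.1 - w.1| <= rho.
    rewrite -(subrKA z.1); apply: le_trans (ler_normD _ _) _.
    by rewrite (distrC x.1); lra.
  have : `|x.2 - w.2| <= rho.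
    rewrite -(subrKA z.2); apply: le_trans (ler_normD _ _) _.
    by rewrite (distrC x.2); lra.
  rewrite /dist2 -(real_normK (num_real (x.1 - w.1))).
  rewrite -(real_normK (num_real (x.2 - w.2))).
  have := normr_ge0 (x.1 - w.1); have := normr_ge0 (x.2 - w.2).
  move: (`|x.1 - _|) (`|x.2 - _|) => p q q0 p0 h1 h2; nra.
Qed.

End unique_continuation.

(* Gluing [n ^+ 2] on a clopen part with 0 elsewhere is harmless across the
   zeros of [n], where [n ^+ 2] vanishes together with its derivative. *)
Lemma connected_hol_neq0 (R : realType) (D : set (R * R)) (n : R * R -> R[i]) :
  open D -> connected D -> hol D n -> connected (D `&` [set z | n z != 0]).
Proof.
move=> oD cD Hn B [b Bb] [G oG BG] [F cF BF].
have oD' := open_hol_neq0 oD Hn; set D' := D `&` _ in oD' BG BF *.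
have oB : open B by rewrite BG; exact: openI.
have oB' : open (D' `&` ~` F) by apply: openI => //; exact: closed_openC.
rewrite eqEsubset; split; first by rewrite BG => z [].
move=> z0 D'z0; apply: contrapT => Bz0.
have D'B z : D' z -> ~ B z -> (D' `&` ~` F) z.
  by move=> D'z Bz; split => // Fz; apply: Bz; rewrite BF .
have nB' z : (D' `&` ~` F) z -> \forall w \near z, ~ B w.
  move=> Hz; have : nbhs z (D' `&` ~` F) by exact: open_nbhs_nbhs.
  by apply: filterS => w [_ Fw]; rewrite BF => -[].
have [n' Hn'] := Hn.
have Hg : hol D (restrict0 B (fun z => n z * n z)).
  apply: (hol_restrict0 oD (hol_withM oD Hn' Hn')) => z Dz.
  have [nz|nz] := eqVneq (n z) 0; first by apply: Or33; rewrite nz !mul0r addr0.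
  have [Bz|Bz] := pselect (B z).
    by apply: Or31; exact: open_nbhs_nbhs.
  by apply: Or32; apply: nB'; apply: D'B.
have g0 : forall z, D z -> restrict0 B (fun z => n z * n z) z = 0.
  apply: (hol_identity oD Hg cD (z0 := z0)); first by case: D'z0.
  by apply: filterS (nB' _ (D'B _ D'z0 Bz0)) => w Bw; rewrite /restrict0 asboolF.
have : D' b by rewrite BG in Bb; case: Bb.
move=> [Db /eqP]; apply; have /eqP := g0 _ Db.
by rewrite /restrict0 asboolT// mulf_eq0 orbb => /eqP.
Qed.

Lemma derive_near0 (R : realType) (u : R * R -> R) (z v : R * R) :
  (\forall h \near (0 : R), u (h *: v + z) = 0) -> 'D_v u z = 0.
Proof.
move=> H; have uz : u z = 0.
  by have := nbhs_singleton H; rewrite scale0r add0r.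
apply: cvg_lim => //.
have c0 : (fun=> (0 : R)) @ (0 : R)^' --> (0 : R) by exact: cvg_cst.
apply: cvg_trans c0; apply: near_eq_cvg; apply: cvg_within.
by apply: filterS H => h /= ->; rewrite uz subrr scaler0.
Qed.

Lemma hol_real_axis (R : realType) (D : set (R * R)) (c : R * R -> R[i])
    (x0 : R) :
  open D -> connected D -> hol D c -> D (x0, 0) ->
  (forall x, D (x, 0) -> c (x, 0) = 0) -> forall z, D z -> c z = 0.
Proof.
move=> oD cD Hc Dx0 Z.
(* By the Cauchy-Riemann equations the derivative of [c] also vanishes on the
   real axis, so [c] can be replaced by 0 below it. *)
pose up := [set z : R * R | 0 < z.2].
have oup : open up.
  apply: (@open_comp _ _ snd [set y : R | 0 < y]); last exact: open_gt.
  by move=> z _; exact: cvg_snd.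
pose low := [set z : R * R | z.2 < 0].
have olow : open low.
  apply: (@open_comp _ _ snd [set y : R | y < 0]); last exact: open_lt.
  by move=> z _; exact: cvg_snd.
have [d Hd] := Hc.
have d0 x : D (x, 0) -> d (x, 0) = 0.
  move=> Dx; have [H1 H2] := Hd.
  have [[_ d1] _ _ _] := H1 _ Dx; have [[_ d2] _ _ _] := H2 _ Dx.
  have /nbhs_ballP[r /= r0 rD] : nbhs (x, 0) D by exact: open_nbhs_nbhs.
  have cx : \forall h \near (0 : R), c (h *: (1, 0) + (x, 0)) = 0.
    apply/nbhs_ballP; exists r => // h hr.
    have -> : h *: (1, 0) + (x, 0) = (x + h, 0) :> R * R.
      by congr pair; rewrite /= ?[h *: _]mulr1 ?scaler0 ?addr0// addrC.
    apply: Z; apply: rD; split; last exact: ballxx.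
    by move: hr; rewrite /ball/= opprD addrA subrr !sub0r !normrN.
  apply: complex_ext; rewrite /= -?d1 -?d2; apply: derive_near0.
  - by apply: filterS cx => h ->.
  - by apply: filterS cx => h ->.
have Hg : hol D (restrict0 up c).
  apply: (hol_restrict0 oD Hd) => -[x y] Dz.
  have [y0|y0|y0] := ltgtP y 0.
  - apply: Or32; have : nbhs (x, y) low by exact: open_nbhs_nbhs.
    by apply: filterS => w; rewrite /low /up /= => /ltW; rewrite leNgt => /negP.
  - by apply: Or31; exact: open_nbhs_nbhs.
  - by apply: Or33; rewrite y0 in Dz *; split; [exact: Z|exact: d0].
have nearD : nbhs (x0, 0) D by exact: open_nbhs_nbhs.
have [r r0 rD] : exists2 r, 0 < r & ball (x0, 0) r `<=` D by exact/nbhs_ballP.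
have Dr (s : R) : `|s| <= r / 2 -> D (x0, s).
  move=> sr; apply: rD; split; first exact: ballxx.
  by rewrite /ball/= sub0r normrN; lra.
have r20 : 0 < r / 2 by rewrite divr_gt0.
(* The cut function is 0 just below [(x0, 0)], hence on all of [D]; so [c] itself is 0 just above,
   and the identity theorem applies a second time, to [c]. *)
have g0 : forall z, D z -> restrict0 up c z = 0.
  apply: (hol_identity oD Hg cD (z0 := (x0, - (r / 2)))).
    by apply: Dr; rewrite normrN gtr0_norm.
  have : nbhs (x0, - (r / 2)) low by apply: open_nbhs_nbhs; split=> //; rewrite /low/= oppr_lt0.
  apply: filterS => w; rewrite /low /restrict0 /= => w0.
  by rewrite asboolF// /up /=; apply/negP; rewrite -leNgt ltW.
apply: (hol_identity oD Hc cD (z0 := (x0, r / 2))).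
  by apply: Dr; rewrite gtr0_norm.
have : nbhs (x0, r / 2) (D `&` up).
  apply: open_nbhs_nbhs; split; first exact: openI.
  by split => //; apply: Dr; rewrite gtr0_norm.
apply: filterS => w [Dw upw]; have := g0 _ Dw.
by rewrite /restrict0 asboolT.
Qed.

(** * Quaternions over a commutative ring *)

(** One construction for three coefficient rings: the complex numbers for the values of stems,
    [sfun] for regular functions, and a field of fractions for their quotients. *)
Record hq (T : Type) := HQ { h0 : T; h1 : T; h2 : T; h3 : T }.

Definition hq_tuple (T : Type) (x : hq T) := (h0 x, h1 x, h2 x, h3 x).
Definition tuple_hq (T : Type) (t : T * T * T * T) :=
  let: (a, b, c, d) := t in HQ a b c d.

Lemma hq_tupleK (T : Type) : cancel (@hq_tuple T) (@tuple_hq T).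
Proof. by case. Qed.

HB.instance Definition _ (T : choiceType) :=
  Choice.copy (hq T) (can_type (@hq_tupleK T)).

Section hq_ring.
Variable T : comNzRingType.
Implicit Types x y z : hq T.

Definition hzero : hq T := HQ 0 0 0 0.
Definition hone : hq T := HQ 1 0 0 0.
Definition hadd x y : hq T :=
  HQ (h0 x + h0 y) (h1 x + h1 y) (h2 x + h2 y) (h3 x + h3 y).
Definition hopp x : hq T := HQ (- h0 x) (- h1 x) (- h2 x) (- h3 x).
Definition hmul x y : hq T :=
  HQ (h0 x * h0 y - h1 x * h1 y - h2 x * h2 y - h3 x * h3 y)
     (h0 x * h1 y + h1 x * h0 y + h2 x * h3 y - h3 x * h2 y)
     (h0 x * h2 y - h1 x * h3 y + h2 x * h0 y + h3 x * h1 y)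
     (h0 x * h3 y + h1 x * h2 y - h2 x * h1 y + h3 x * h0 y).

Lemma haddA : associative hadd.
Proof. by move=> x y z; congr HQ; rewrite /= addrA. Qed.
Lemma haddC : commutative hadd.
Proof. by move=> x y; congr HQ; rewrite addrC. Qed.
Lemma hadd0 : left_id hzero hadd.
Proof. by case=> a b c d; congr HQ; rewrite /= add0r. Qed.
Lemma haddN : left_inverse hzero hopp hadd.
Proof. by move=> x; congr HQ; rewrite /= addNr. Qed.

HB.instance Definition _ :=
  GRing.isZmodule.Build (hq T) haddA haddC hadd0 haddN.

Lemma hmulA : associative hmul.
Proof. by move=> x y z; congr HQ; rewrite /=; ring. Qed.
Lemma hmul1l : left_id hone hmul.
Proof. by case=> a b c d; congr HQ; rewrite /=; ring. Qed.
Lemma hmul1r : right_id hone hmul.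
Proof. by case=> a b c d; congr HQ; rewrite /=; ring. Qed.
Lemma hmulDl : left_distributive hmul hadd.
Proof. by move=> x y z; congr HQ; rewrite /=; ring. Qed.
Lemma hmulDr : right_distributive hmul hadd.
Proof. by move=> x y z; congr HQ; rewrite /=; ring. Qed.
Lemma hone_neq0 : hone != hzero.
Proof. by apply/eqP => /(congr1 (@h0 T))/eqP; rewrite oner_eq0. Qed.

HB.instance Definition _ := GRing.Zmodule_isNzRing.Build (hq T)
  hmulA hmul1l hmul1r hmulDl hmulDr hone_neq0.

Definition hc (t : T) : hq T := HQ t 0 0 0.
Definition hconj x : hq T := HQ (h0 x) (- h1 x) (- h2 x) (- h3 x).
Definition hnorm x : T :=
  h0 x * h0 x + h1 x * h1 x + h2 x * h2 x + h3 x * h3 x.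

Lemma hc_comm t x : x * hc t = hc t * x.
Proof. by congr HQ; rewrite /=; ring. Qed.
Lemma hcM s t : hc (s * t) = hc s * hc t.
Proof. by congr HQ; rewrite /=; ring. Qed.
Lemma hc1 : hc 1 = 1. Proof. by []. Qed.
Lemma hc0 : hc 0 = 0. Proof. by []. Qed.
Lemma hc_eq0 t : (hc t == 0) = (t == 0).
Proof. by apply/eqP/eqP => [[]//|->]. Qed.
Lemma hmul_conj x : x * hconj x = hc (hnorm x).
Proof. by congr HQ; rewrite /hnorm /=; ring. Qed.
Lemma hconj_mul x : hconj x * x = hc (hnorm x).
Proof. by congr HQ; rewrite /hnorm /=; ring. Qed.
Lemma hnormM x y : hnorm (x * y) = hnorm x * hnorm y.
Proof. by rewrite /hnorm /=; ring. Qed.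
Lemma hconj_hc t : hconj (hc t) = hc t.
Proof. by rewrite /hconj /hc /= oppr0. Qed.
Lemma hnorm1 : hnorm 1 = 1. Proof. by rewrite /hnorm /=; ring. Qed.
Lemma hnorm_hc t : hnorm (hc t) = t * t.
Proof. by rewrite /hnorm /=; ring. Qed.

End hq_ring.

Section hq_field.
Variable F : fieldType.
Implicit Types x y : hq F.

(** Over an arbitrary field a nonzero quaternion may have norm 0, so the units are the elements of
    nonzero norm; elsewhere the unit ring structure expects the identity. *)
Definition hinv x : hq F :=
  if hnorm x == 0 then x else hc (hnorm x)^-1 * hconj x.

Lemma hmulV : {in [pred x | hnorm x != 0], left_inverse 1 hinv *%R}.
Proof.
move=> x; rewrite inE /hinv => n0; rewrite (negbTE n0).
by rewrite -mulrA hconj_mul -hcM mulVf.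
Qed.

Lemma hmulrV : {in [pred x | hnorm x != 0], right_inverse 1 hinv *%R}.
Proof.
move=> x; rewrite inE /hinv => n0; rewrite (negbTE n0).
by rewrite mulrA hc_comm -mulrA hmul_conj -hcM mulVf.
Qed.

Lemma hunitP x y : y * x = 1 /\ x * y = 1 -> x \in [pred x | hnorm x != 0].
Proof.
move=> [/(congr1 (@hnorm F)) + _]; rewrite hnormM hnorm1 inE => h.
by apply: contra_eq_neq h => ->; rewrite mulr0 eq_sym oner_eq0.
Qed.

Lemma hinv_out : {in [predC [pred x | hnorm x != 0]], hinv =1 id}.
Proof. by move=> x; rewrite !inE negbK /hinv => ->. Qed.

HB.instance Definition _ := GRing.NzRing_hasMulInverse.Build (hq F)
  hmulV hmulrV hunitP hinv_out.

Lemma hq_unitE x : (x \is a GRing.unit) = (hnorm x != 0).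
Proof. by []. Qed.

Lemma hcV t : t != 0 -> (hc t : hq F)^-1 = hc t^-1.
Proof.
move=> t0; have ut : (hc t : hq F) \is a GRing.unit.
  by rewrite hq_unitE hnorm_hc mulf_neq0.
by apply: (mulrI ut); rewrite mulrV// -hcM mulfV.
Qed.

End hq_field.

Section hq_map.
Variables (S T : comNzRingType) (f : {rmorphism S -> T}).

Definition hmap (x : hq S) : hq T :=
  HQ (f (h0 x)) (f (h1 x)) (f (h2 x)) (f (h3 x)).

Lemma hmap_is_zmod_morphism : zmod_morphism hmap.
Proof. by move=> x y; congr HQ; rewrite /= rmorphB. Qed.

Lemma hmap_is_monoid_morphism : monoid_morphism hmap.
Proof.
split; first by rewrite /hmap /= rmorph1 !rmorph0.
by move=> x y; congr HQ; rewrite /= ?(rmorphB, rmorphD) /= !rmorphM.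
Qed.

HB.instance Definition _ := GRing.isZmodMorphism.Build (hq S) (hq T) hmap
  hmap_is_zmod_morphism.
HB.instance Definition _ := GRing.isMonoidMorphism.Build (hq S) (hq T) hmap
  hmap_is_monoid_morphism.

Lemma hmap_hc t : hmap (hc t) = hc (f t).
Proof. by rewrite /hmap /hc /= rmorph0. Qed.

Lemma hnorm_hmap x : hnorm (hmap x) = f (hnorm x).
Proof. by rewrite /hnorm !rmorphD /= !rmorphM. Qed.

Lemma hmap_inj : injective f -> injective hmap.
Proof.
by move=> fi [a b c d] [a' b' c' d'] [/fi-> /fi-> /fi-> /fi->].
Qed.

End hq_map.

(** * Ore conditions and quotient rings for quaternions with anisotropic norm *)

Definition sum4sq_free (T : comNzRingType) := forall a b c d : T,
  a * a + b * b + c * c + d * d = 0 -> [/\ a = 0, b = 0, c = 0 & d = 0].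

Lemma hnorm_eq0 (T : comNzRingType) (x : hq T) :
  sum4sq_free T -> hnorm x = 0 -> x = 0.
Proof. by case: x => a b c d H /H /= [-> -> -> ->]. Qed.

Section hq_Ore.
Variable T : idomainType.
Hypothesis sqT : sum4sq_free T.

Lemma hq_integral : GRing.integral_domain_axiom (hq T).
Proof.
move=> x y /(congr1 (@hnorm T)); rewrite hnormM [RHS]/hnorm /= !mulr0 !addr0.
move/eqP; rewrite mulf_eq0 => /orP[] /eqP /(hnorm_eq0 sqT) ->; rewrite eqxx ?orbT//.
Qed.

Lemma hnorm_neq0 (a : hq T) : a != 0 -> hnorm a != 0.
Proof. by apply: contra_neq => /(hnorm_eq0 sqT). Qed.

(** Norms are central and are multiples of their argument on both sides, so [hnorm a * hnorm b] is a
    common left and right multiple of [a] and [b]. *)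
Lemma hq_left_Ore : left_Ore_domain (hq T).
Proof.
split; first exact: hq_integral.
move=> a b a0 b0; exists (hc (hnorm a * hnorm b)).
  by rewrite hc_eq0 mulf_neq0// hnorm_neq0.
split.
- by exists (hc (hnorm b) * hconj a); rewrite -mulrA hconj_mul -hcM mulrC.
- by exists (hc (hnorm a) * hconj b); rewrite -mulrA hconj_mul -hcM.
Qed.

Lemma hq_right_Ore : right_Ore_domain (hq T).
Proof.
split; first exact: hq_integral.
move=> a b a0 b0; exists (hc (hnorm a * hnorm b)).
  by rewrite hc_eq0 mulf_neq0// hnorm_neq0.
split.
- by exists (hconj a * hc (hnorm b)); rewrite mulrA hmul_conj -hcM.
- by exists (hconj b * hc (hnorm a)); rewrite mulrA hmul_conj -hcM mulrC.
Qed.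

End hq_Ore.

(* [K] stands for the field of fractions of [T]; keeping it abstract prevents
   the unfolding of the quotient type [{fraction T}]. *)
Section hq_fractions.
Variables (T : idomainType) (K : fieldType) (f : {rmorphism T -> K}).
Hypothesis sqT : sum4sq_free T.
Hypothesis f_inj : injective f.
Hypothesis f_frac : forall r : K, exists n d : T, d != 0 /\ r = f n / f d.

Let f_eq0 t : (f t == 0) = (t == 0).
Proof. by rewrite -(inj_eq f_inj) rmorph0. Qed.

Lemma common_denominator (x : hq K) :
  exists (n : T) (X : hq T), n != 0 /\ hc (f n) * x = hmap f X.
Proof.
case: x => a b c d.
have [a1 [a2 [a20 ->]]] := f_frac a; have [b1 [b2 [b20 ->]]] := f_frac b.
have [c1 [c2 [c20 ->]]] := f_frac c; have [d1 [d2 [d20 ->]]] := f_frac d.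
exists (a2 * b2 * c2 * d2).
exists (HQ (a1 * b2 * c2 * d2) (b1 * a2 * c2 * d2) (c1 * a2 * b2 * d2)
  (d1 * a2 * b2 * c2)).
split; first by rewrite !mulf_neq0.
have E (t : T) : t != 0 -> f t != 0 by rewrite f_eq0.
by congr HQ; rewrite /= !rmorphM /=; field; rewrite !E.
Qed.

(** Clearing a common denominator scales the four squares by one nonzero square and brings the
    relation back to [T]. *)
Lemma sum4sq_free_fraction : sum4sq_free K.
Proof.
move=> a b c d H; have [n [X [n0 E]]] := common_denominator (HQ a b c d).
have fn0 : f n != 0 by rewrite f_eq0.
have /(hnorm_eq0 sqT) X0 : hnorm X = 0.
  apply/eqP; rewrite -f_eq0 -hnorm_hmap -E hnormM.
  by rewrite [hnorm (HQ _ _ _ _)]H mulr0.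
move: E; rewrite X0 rmorph0 => -[].
have Z t : f n * t = 0 -> t = 0.
  by move/eqP; rewrite mulf_eq0 (negbTE fn0) => /eqP.
by rewrite !mul0r !addr0 !subr0 => /Z-> /Z-> /Z-> /Z->.
Qed.

Lemma hq_division : division_ring (hq K).
Proof.
move=> x; apply: contra_neqT; rewrite hq_unitE negbK => /eqP.
exact: hnorm_eq0 sum4sq_free_fraction.
Qed.

Lemma hq_quotient_denominator (x : hq K) :
  exists (n : T) (X : hq T), n != 0 /\ x = hc (f n)^-1 * hmap f X.
Proof.
have [n [X [n0 E]]] := common_denominator x; exists n, X; split => //.
by rewrite -E mulrA -hcM mulVf ?f_eq0// hc1 mul1r.
Qed.

Lemma hq_left_quotient : left_quotient_ring (hmap f).
Proof.
split; [exact: hq_division|exact: hmap_inj|move=> x].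
have [n [X [n0 ->]]] := hq_quotient_denominator x; exists (hc n), X.
by rewrite hc_eq0 n0 /= hmap_hc hcV ?f_eq0.
Qed.

Lemma hq_right_quotient : right_quotient_ring (hmap f).
Proof.
split; [exact: hq_division|exact: hmap_inj|move=> x].
have [n [X [n0 ->]]] := hq_quotient_denominator x; exists (hc n), X.
by rewrite hc_eq0 n0 /= hmap_hc hcV ?f_eq0// hc_comm.
Qed.

End hq_fractions.

Lemma tofrac_frac (T : idomainType) (r : {fraction T}) :
  exists n d : T, d != 0 /\ r = FracField.tofrac n / FracField.tofrac d.
Proof.
elim/quotW: r => x; exists (frac x).1, (frac x).2; split; first exact: denom_ratioP.
have d0 : FracField.tofrac (frac x).2 != 0.
  by rewrite tofrac_eq0 denom_ratioP.
apply: (mulIf d0); rewrite divfK//; unlock FracField.tofrac.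
rewrite -[LHS]FracField.pi_mul; apply/eqmodP; rewrite /= FracField.equivfE.
rewrite /FracField.mulf !numden_Ratio ?(oner_neq0, mulf_neq0, denom_ratioP)//.
by rewrite !mulr1 mulrC.
Qed.

(** * Quaternionic values of stems *)

Definition qre (R : realType) (X : hq R[i]) : quat R :=
  mkquat (Re (h0 X)) (Re (h1 X)) (Re (h2 X)) (Re (h3 X)).
Definition qim (R : realType) (X : hq R[i]) : quat R :=
  mkquat (Im (h0 X)) (Im (h1 X)) (Im (h2 X)) (Im (h3 X)).
(** The value on the slice of [K] of a stem with value [X]: the complex unit is replaced by [K], on
    the left as in the Cauchy-Riemann equation of [holomorphic]. This is additive, but not
    multiplicative. *)
Definition ev (R : realType) (K : quat R) (X : hq R[i]) : quat R :=
  qre X + K * qim X.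
Definition emb (R : realType) (K : quat R) (c : R[i]) : quat R :=
  qpoint K (Re c, Im c).
(** Conjugation of the complex coefficients, to be distinguished from the quaternionic conjugation
    [hconj], with which it commutes. *)
Definition hbar (R : realType) (X : hq R[i]) : hq R[i] :=
  HQ (conjc (h0 X)) (conjc (h1 X)) (conjc (h2 X)) (conjc (h3 X)).

Section quaternion_values.
Context {R : realType}.
Implicit Types (K p q : quat R) (X Y : hq R[i]) (c : R[i]) (z : R * R).

Lemma qconjD p q : qconj (p + q) = qconj p + qconj q.
Proof. by apply: quatP; rewrite /qconj !(qaddE, mkquatE); ring. Qed.
Lemma qconjN p : qconj (- p) = - qconj p.
Proof. by apply: quatP; rewrite /qconj !(qoppE, mkquatE). Qed.
Lemma qconjM p q : qconj (p * q) = qconj q * qconj p.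
Proof. by apply: quatP; rewrite !qmulE /qconj /qmul !mkquatE; ring. Qed.
Lemma qdotDl p q r : qdot (p + q) r = qdot p r + qdot q r.
Proof. by rewrite !qdotE !qaddE; ring. Qed.
Lemma qdotNl p r : qdot (- p) r = - qdot p r.
Proof. by rewrite !qdotE !qoppE; ring. Qed.
Lemma qdotNr p r : qdot p (- r) = - qdot p r.
Proof. by rewrite !qdotE !qoppE; ring. Qed.
Lemma qdotMl p q r : qdot (p * q) r = qdot q (qconj p * r).
Proof. by rewrite !qdotE !qmulE /qmul /qconj !mkquatE; ring. Qed.

Lemma imag_sqr K : imag_unit K -> K * K = -1.
Proof. by rewrite /imag_unit /= expr2. Qed.

Lemma imag_unitN K : imag_unit K -> imag_unit (- K).
Proof. by rewrite /imag_unit /= sqrrN. Qed.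

Lemma imag_conj K : imag_unit K -> qconj K = - K.
Proof.
move=> /imag_unitP[K0 _]; apply: quatP; rewrite /qconj !(qoppE, mkquatE)//.
by rewrite K0 oppr0.
Qed.

Lemma imag_anticomm (I J : quat R) : imag_unit I -> imag_unit J ->
  qdot I J = 0 -> J * I = - (I * J).
Proof.
move=> /imag_unitP[I0 _] /imag_unitP[J0 _]; rewrite qdotE I0 mul0r add0r => H.
apply: quatP; rewrite qoppE !qmulE /qmul !mkquatE I0 J0; [|ring..].
by move: H; lra.
Qed.

Lemma qpoint_comm K z : qpoint K z * K = K * qpoint K z.
Proof.
by rewrite /qpoint mulrDl mulrDr -!scalerAl -!scalerAr mul1r mulr1.
Qed.

Lemma qpointN K z : qpoint (- K) z = qpoint K (bar z).
Proof. by rewrite /qpoint /bar /= scalerN scaleNr. Qed.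

Lemma qpoint_real K (x : R) : qpoint K (x, 0) = x%:A.
Proof. by rewrite /qpoint /= scale0r addr0. Qed.

Lemma qconj_qpoint K z : imag_unit K -> qconj (qpoint K z) = qpoint K (bar z).
Proof.
move=> /imag_unitP[K0 _]; apply: quatP;
  by rewrite /qconj /qpoint /bar /= qoneE !(qaddE, qscaleE, mkquatE) ?K0; ring.
Qed.

Lemma qpoint_anticomm (I J : quat R) z : imag_unit I -> imag_unit J ->
  qdot I J = 0 -> J * qpoint I z = qconj (qpoint I z) * J.
Proof.
move=> hI hJ hIJ; rewrite qconj_qpoint// /qpoint /bar /= mulrDl mulrDr.
rewrite -!scalerAl -!scalerAr mul1r mulr1 imag_anticomm//.
by rewrite scalerN scaleNr.
Qed.

Lemma qpoint_neq0 K z : imag_unit K -> qpoint K z = 0 -> z = (0, 0).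
Proof.
move=> hK H; have [K0 K1] := imag_unitP hK.
have E i : qpoint K z 0 i = 0 by rewrite H mxE.
have := E 0; have := E 1; have := E 2; have := E 3.
rewrite /qpoint qoneE !(qaddE, qscaleE, mkquatE) K0.
rewrite !mulr0 !mulr1 !add0r addr0 => e3 e2 e1 e0.
case: z e0 e1 e2 e3 {H E} => x y /= -> e1 e2 e3; congr pair.
have : y ^+ 2 = (y * K 0 1) ^+ 2 + (y * K 0 2) ^+ 2 + (y * K 0 3) ^+ 2.
  by rewrite !exprMn -!mulrDr K1 mulr1.
by rewrite e1 e2 e3 expr0n !addr0 => /eqP; rewrite sqrf_eq0 => /eqP.
Qed.

Lemma emb0 K : emb K 0 = 0.
Proof. by rewrite /emb /qpoint /= !scale0r addr0. Qed.

Lemma emb1 K : emb K 1 = 1.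
Proof. by rewrite /emb /qpoint /= scale0r addr0 scale1r. Qed.

Lemma embM K c d : imag_unit K -> emb K (c * d) = emb K c * emb K d.
Proof.
move=> /imag_sqr hK; rewrite /emb /qpoint /= Re_mulc Im_mulc.
rewrite mulrDl !mulrDr -!scalerAl -!scalerAr !mul1r !mulr1 hK.
rewrite !scalerA scalerBl !scalerDl scalerN.
by rewrite -!addrA; congr (_ + _); rewrite addrC -!addrA.
Qed.

Lemma emb_neq0 K c : imag_unit K -> c != 0 -> emb K c != 0.
Proof.
move=> hK; apply: contra_neq => /(qpoint_neq0 hK) [] h1 h2.
exact: complex_ext.
Qed.

Lemma embV K c : imag_unit K -> (emb K c)^-1 = emb K c^-1.
Proof.
move=> hK; have [->|c0] := eqVneq c 0; first by rewrite invr0 emb0 invr0.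
have u : emb K c \is a GRing.unit by exact: emb_neq0.
by apply: (mulrI u); rewrite mulrV// -embM// mulfV// emb1.
Qed.

Lemma qreM X Y : qre (X * Y) = qre X * qre Y - qim X * qim Y.
Proof.
by apply: quatP; rewrite qaddE qoppE !qmulE /qmul /qre /qim !mkquatE /=
  ?(Re_addc, Re_oppc, Re_mulc); ring.
Qed.

Lemma qimM X Y : qim (X * Y) = qre X * qim Y + qim X * qre Y.
Proof.
by apply: quatP; rewrite qaddE !qmulE /qmul /qre /qim !mkquatE /=
  ?(Im_addc, Im_oppc, Im_mulc); ring.
Qed.

(** The unit coming from the second factor is pulled to the far left, past the value of the first;
    this is where the star product departs from the pointwise one. *)
Lemma evM K X Y : imag_unit K ->
  ev K (X * Y) = ev K X * qre Y + K * ev K X * qim Y.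
Proof.
move=> /imag_sqr hK; rewrite /ev qreM qimM mulrDl [K * (qre X + _)]mulrDr.
rewrite !mulrDr [(_ + K * _) * qim Y]mulrDl !mulrA hK mulN1r mulNr.
rewrite -!addrA; congr (_ + _).
by rewrite [LHS]addrC -addrA [LHS]addrCA.
Qed.

Lemma evD K X Y : ev K (X + Y) = ev K X + ev K Y.
Proof.
have hre : qre (X + Y) = qre X + qre Y.
  by apply: quatP; rewrite qaddE /qre !mkquatE /= Re_addc.
have him : qim (X + Y) = qim X + qim Y.
  by apply: quatP; rewrite qaddE /qim !mkquatE /= Im_addc.
by rewrite /ev hre him mulrDr addrACA.
Qed.

Lemma ev_hc K c : ev K (hc c) = emb K c.
Proof.
by apply: quatP; rewrite /ev /emb /qpoint qmulE qoneE !(qaddE, qscaleE)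
  /qmul /qre /qim !mkquatE /=; ring.
Qed.

Lemma ev_central K c X : imag_unit K -> ev K (hc c * X) = emb K c * ev K X.
Proof.
move=> hK; rewrite evM// ev_hc /emb -qpoint_comm.
by rewrite /ev mulrDr !mulrA.
Qed.

Lemma qim_hbar X : qim (hbar X) = - qim X.
Proof.
by apply: quatP; rewrite qoppE /qim !mkquatE /=;
  match goal with |- context [conjc ?c] => case: c end.
Qed.

Lemma qre_hbar X : qre (hbar X) = qre X.
Proof.
by apply: quatP; rewrite /qre !mkquatE /=;
  match goal with |- context [conjc ?c] => case: c end.
Qed.

Lemma ev_hbar K X : ev K (hbar X) = ev (- K) X.
Proof. by rewrite /ev qre_hbar qim_hbar mulrN mulNr. Qed.

Lemma qre_hconj X : qre (hconj X) = qconj (qre X).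
Proof. by apply: quatP; rewrite /qre /qconj !mkquatE //= Re_oppc. Qed.

Lemma qim_hconj X : qim (hconj X) = qconj (qim X).
Proof. by apply: quatP; rewrite /qim /qconj !mkquatE //= Im_oppc. Qed.

Lemma hq_ext X Y : qre X = qre Y -> qim X = qim Y -> X = Y.
Proof.
move=> hr hi; have E i := congr1 (fun q : quat R => q 0 i) hr.
have F i := congr1 (fun q : quat R => q 0 i) hi.
move: (E 0) (E 1) (E 2) (E 3) (F 0) (F 1) (F 2) (F 3).
rewrite /qre /qim !mkquatE; case: X Y {hr hi E F} => [a b c d] [a' b' c' d'] /=.
by move=> *; congr HQ; apply: complex_ext.
Qed.

(** A single value has four real components and a stem value eight, so two opposite units are
    compared; their sum and difference isolate [qre] and [qim]. *)
Lemma ev_inj K X Y : imag_unit K -> ev K X = ev K Y ->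
  ev (- K) X = ev (- K) Y -> X = Y.
Proof.
rewrite /ev !mulNr => hK e1 e2.
have K0 : K \is a GRing.unit.
  change (K != 0); apply/eqP => K0; move: (imag_sqr hK).
  by rewrite K0 mul0r => /eqP; rewrite eq_sym oppr_eq0 oner_eq0.
have dbl (p q : quat R) : p + p = q + q -> p = q.
  move=> h; apply/rowP => i.
  by have := congr1 (fun q : quat R => q 0 i) h; rewrite !qaddE; lra.
have hr : qre X = qre Y.
  apply: dbl; have := congr2 +%R e1 e2.
  by rewrite addrACA subrr addr0 addrACA subrr addr0.
apply: hq_ext => //; apply: (mulrI K0).
by move: e1; rewrite hr => /addrI.
Qed.

(** * Splitting with respect to two orthogonal units *)

Section splitting.
Variables (I J : quat R).
Hypotheses (hI : imag_unit I) (hJ : imag_unit J) (hIJ : qdot I J = 0).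

Lemma fst_partD p q : fst_part I (p + q) = fst_part I p + fst_part I q.
Proof. by rewrite /fst_part /qpoint /= !qdotDl !scalerDl addrACA. Qed.

Lemma snd_partD p q : snd_part I J (p + q) = snd_part I J p + snd_part I J q.
Proof. by rewrite /snd_part /qpoint /= !qdotDl !scalerDl addrACA. Qed.

Lemma fst_part_mulI q : fst_part I (I * q) = I * fst_part I q.
Proof.
rewrite /fst_part !qdotMl imag_conj// mulr1 mulNr imag_sqr// opprK.
rewrite /qpoint /= mulrDr -!scalerAr mulr1 imag_sqr// qdotNr.
by rewrite scalerN scaleNr addrC.
Qed.

Lemma snd_part_mulI q : snd_part I J (I * q) = I * snd_part I J q.
Proof.
rewrite /snd_part !qdotMl imag_conj// !mulNr mulrA imag_sqr// mulN1r opprK.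
rewrite /qpoint /= mulrDr -!scalerAr mulr1 imag_sqr// qdotNr.
by rewrite scalerN scaleNr addrC.
Qed.

(** Moving [J] to the left of [H] and [K] conjugates them, so the formula regroups as
    [F * ev I Y + G * J * ev (- I) Y]. As [F] commutes with [I] and [G * J] anticommutes with it,
    both terms acquire [I] on the far left, which gives [evM]. *)
Lemma star_identity X Y :
  let F := fst_part I (ev I X) in let G := snd_part I J (ev I X) in
  let H := fst_part I (ev I Y) in let K := snd_part I J (ev I Y) in
  (F * H - G * qconj (snd_part I J (ev I (hbar Y)))) +
  (F * K + G * qconj (fst_part I (ev I (hbar Y)))) * J = ev I (X * Y).
Proof.
move=> F G H K; set H' := fst_part I (ev I (hbar Y)).
set K' := snd_part I J (ev I (hbar Y)).
have eX : ev I X = F + G * J by exact: partE.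
have eY : ev I Y = H + K * J by exact: partE.
have eY' : ev I (hbar Y) = H' + K' * J by exact: partE.
have jY : J * ev I (hbar Y) = qconj H' * J - qconj K'.
  rewrite eY' mulrDr mulrA qpoint_anticomm// qpoint_anticomm//.
  by rewrite -!mulrA imag_sqr// mulrN1.
have GJI : G * J * I = - (I * (G * J)).
  by rewrite -mulrA (imag_anticomm hI hJ hIJ) mulrN !mulrA qpoint_comm.
have FI : F * I = I * F by exact: qpoint_comm.
clearbody F G H K H' K'.
transitivity (F * ev I Y + G * (J * ev I (hbar Y))).
  rewrite eY jY !mulrDr mulrDl mulrN !mulrA -!addrA; congr (_ + _).
  by rewrite [LHS]addrC -addrA.
rewrite evM// mulrA ev_hbar eX.
have eP : ev I Y = qre Y + I * qim Y by [].
have eQ : ev (- I) Y = qre Y - I * qim Y by rewrite /ev mulNr.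
rewrite eP eQ [F * _]mulrDr [G * J * _]mulrBr !mulrA FI GJI.
by rewrite mulNr opprK addrACA -!mulrDl -mulrDr.
Qed.

(** Quaternionic conjugation is applied to [qre X] and [qim X] separately. On the first component it
    turns the factor [I] into [- I], and evaluation at the conjugate point restores the sign. *)
Lemma conjugate_identity X :
  qconj (fst_part I (ev I (hbar X))) - snd_part I J (ev I X) * J =
  ev I (hconj X).
Proof.
have S z : J * qconj (qpoint I z) = qpoint I z * J.
  rewrite (qconj_qpoint z hI) (qpoint_anticomm _ hI hJ hIJ).
  by rewrite (qconj_qpoint _ hI) barK.
have C (q : quat R) : qconj q = qconj (fst_part I q) - snd_part I J q * J.
  rewrite {1}(partE q hI hJ hIJ) qconjD qconjM (imag_conj hJ) mulNr.
  by rewrite [J * _]S.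
have e1 : fst_part I (ev I (hbar X)) =
    fst_part I (qre X) - I * fst_part I (qim X).
  rewrite /ev qre_hbar qim_hbar fst_partD fst_part_mulI -mulrN.
  by congr (_ + _ * _); rewrite /fst_part /qpoint !qdotNl /= !scaleNr opprD.
have e2 : snd_part I J (ev I X) =
    snd_part I J (qre X) + I * snd_part I J (qim X).
  by rewrite /ev snd_partD snd_part_mulI.
have e3 z : qconj (I * qpoint I z) = - (I * qconj (qpoint I z)).
  by rewrite qconjM (imag_conj hI) mulrN (qconj_qpoint z hI) qpoint_comm.
rewrite /ev qre_hconj qim_hconj -/(ev I X) -/(ev I (hbar X)) e1 e2.
rewrite (C (qre X)) (C (qim X)) qconjD qconjN [qconj (I * _)]e3 opprK.
by rewrite mulrDl opprD mulrBr mulrA addrACA.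
Qed.

End splitting.

End quaternion_values.

(** * Slice regularity and stems *)

Lemma ord4_ind (P : 'I_4 -> Prop) : P 0 -> P 1 -> P 2 -> P 3 -> forall i, P i.
Proof.
move=> P0 P1 P2 P3 [[|[|[|[|//]]]] lti].
- by rewrite (_ : Ordinal lti = 0) //; apply: val_inj.
- by rewrite (_ : Ordinal lti = 1) //; apply: val_inj.
- by rewrite (_ : Ordinal lti = 2) //; apply: val_inj.
- by rewrite (_ : Ordinal lti = 3) //; apply: val_inj.
Qed.

Definition qbasis (R : realType) (i : 'I_4) : quat R := delta_mx 0 i.

Lemma qdot_qbasis (R : realType) (q : quat R) i : qdot q (qbasis R i) = q 0 i.
Proof.
rewrite /qdot (bigD1 i)//= big1 ?addr0; first by rewrite !mxE !eqxx mulr1.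
by move=> j ji; rewrite !mxE (negbTE ji) mulr0.
Qed.

(** Tested against every vector [r], not only the basis, so that a left multiplication by [K] can be
    moved onto [r]. *)
Definition qC1_with (R : realType) (U : set (R * R)) (phi p q : R * R -> quat R) :=
  forall r : quat R, C1_with U (fun z => qdot (phi z) r)
    (fun z => qdot (p z) r) (fun z => qdot (q z) r).

Section quaternionic_C1.
Context {R : realType} (U : set (R * R)).
Hypothesis oU : open U.
Implicit Types (phi p q : R * R -> quat R) (K : quat R).

Lemma qC1_with_comp phi p q :
  (forall i, C1_with U (fun z => phi z 0 i) (fun z => p z 0 i)
    (fun z => q z 0 i)) -> qC1_with U phi p q.
Proof.
move=> H r; have L i := C1_withZ oU (r 0 i) (H i).
apply: (C1_with_eq oU _ (C1_withD (C1_withD (C1_withD (L 0) (L 1)) (L 2)) (L 3))).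
by move=> z _; rewrite !qdotE; split; ring.
Qed.

Lemma qC1_with_coord phi p q i : qC1_with U phi p q ->
  C1_with U (fun z => phi z 0 i) (fun z => p z 0 i) (fun z => q z 0 i).
Proof.
move=> H; apply: (C1_with_eq oU _ (H (qbasis R i))) => z _.
by rewrite !qdot_qbasis.
Qed.

Lemma qcontinuous_coord phi z :
  {for z, continuous phi} -> forall i, {for z, continuous (fun w => phi w 0 i)}.
Proof.
move=> cphi i.
exact: (@continuous_comp _ _ _ phi (fun q : 'rV[R]_4 => q 0 i) z cphi
  (@coord_continuous _ _ _ 0 i _)).
Qed.

Lemma coord_qcontinuous phi z :
  (forall i, {for z, continuous (fun w => phi w 0 i)}) ->
  {for z, continuous phi}.
Proof.
move=> H; apply/cvgrPdist_le => e e0; near=> w.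
rewrite [leLHS]/Num.Def.normr/= mx_normrE (bigmax_le _ (ltW e0))//= => -[i j] _.
rewrite (ord1 i) !mxE /=; move: j; near: w; apply: filter_forall => /= j.
by have /cvgrPdist_le := H j; apply.
Unshelve. all: by end_near. Qed.

Lemma qC1_with_holomorphic K phi p : imag_unit K ->
  qC1_with U phi p (fun z => K * p z) -> holomorphic K U phi.
Proof.
move=> hK H; have C i := qC1_with_coord i H.
have D1 z : U z -> derivable phi z (1, 0).
  move=> Uz; apply/derivable_mxP => i j; rewrite (ord1 i).
  by have [[]] := C j z Uz.
have D2 z : U z -> derivable phi z (0, 1).
  move=> Uz; apply/derivable_mxP => i j; rewrite (ord1 i).
  by have [_ []] := C j z Uz.
have E1 z : U z -> p z = 'D_(1, 0) phi z.
  move=> Uz; rewrite (derive_mx (D1 z Uz)); apply/rowP => j; rewrite [RHS]mxE.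
  by have [[_ ->]] := C j z Uz.
have E2 z : U z -> K * p z = 'D_(0, 1) phi z.
  move=> Uz; rewrite (derive_mx (D2 z Uz)); apply/rowP => j; rewrite [RHS]mxE.
  by have [_ [_ ->]] := C j z Uz.
have cont (f g : R * R -> quat R) z : U z -> (forall w, U w -> f w = g w) ->
    {for z, continuous f} -> {for z, continuous g}.
  move=> Uz fg cf; change (g @ z --> g z); rewrite -(fg z Uz).
  apply: cvg_trans cf; apply: near_eq_cvg.
  near=> w; apply: fg; near: w; exact: near_open.
move=> z Uz; split.
- exact: (conj (D1 z Uz) (D2 z Uz)).
- apply: (cont p _ z Uz E1); apply: coord_qcontinuous => i.
  by have [_ _ c _] := C i z Uz.
- apply: (cont (fun z => K * p z) _ z Uz E2); apply: coord_qcontinuous => i.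
  by have [_ _ _ c] := C i z Uz.
- by rewrite -E1// -E2// mulrA imag_sqr// mulN1r subrr scaler0.
Unshelve. all: by end_near. Qed.

Lemma holomorphic_qC1_with K phi : imag_unit K -> holomorphic K U phi ->
  qC1_with U phi ('D_(1, 0) phi) (fun z => K * 'D_(1, 0) phi z).
Proof.
move=> hK H.
have E z : U z -> 'D_(0, 1) phi z = K * 'D_(1, 0) phi z.
  move=> Uz; have [_ _ _ /eqP] := H z Uz.
  rewrite scaler_eq0 invr_eq0 pnatr_eq0 /= => /eqP h.
  have := congr1 (fun q : quat R => K * q) h.
  rewrite mulr0 mulrDr mulrA imag_sqr// mulN1r => /eqP.
  by rewrite subr_eq0 => /eqP ->.
apply: qC1_with_comp => i z Uz; have [[d1 d2] c1 c2 _] := H z Uz.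
have e1 := derive_mx d1; have e2 := derive_mx d2.
split.
- split; first by have /derivable_mxP/(_ 0 i) := d1.
  by rewrite e1 mxE.
- split; first by have /derivable_mxP/(_ 0 i) := d2.
  by rewrite -E// e2 mxE.
- exact: (@qcontinuous_coord ('D_(1, 0) phi) z c1 i).
- apply: (for_continuous_eq oU Uz _ (@qcontinuous_coord ('D_(0, 1) phi) z c2 i)) => w Uw.
  by rewrite E.
Qed.

(** The derivative in [y] is [K] times the derivative [p] in [x], and left multiplication by [K] is
    skew for [qdot]: pairing [K * p] with [r] gives minus the pairing of [p] with [K * r]. These are
    the scalar Cauchy-Riemann equations. *)
Lemma holomorphic_hol K phi r : imag_unit K -> holomorphic K U phi ->
  hol U (fun z => (qdot (phi z) r +i* qdot (phi z) (K * r))%C).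
Proof.
move=> hK /(holomorphic_qC1_with hK) H.
exists (fun z => (qdot ('D_(1, 0) phi z) r +i* qdot ('D_(1, 0) phi z) (K * r))%C).
split.
- apply: (C1_with_eq oU _ (H r)) => z _.
  by rewrite qdotMl imag_conj// mulNr qdotNr.
- apply: (C1_with_eq oU _ (H (K * r))) => z _.
  by rewrite qdotMl imag_conj// mulNr mulrA imag_sqr// mulN1r opprK.
Qed.

Definition hqhol (S : R * R -> hq R[i]) :=
  [/\ hol U (fun z => h0 (S z)), hol U (fun z => h1 (S z)),
      hol U (fun z => h2 (S z)) & hol U (fun z => h3 (S z))].

Lemma hqhol_holomorphic K S : imag_unit K -> hqhol S ->
  holomorphic K U (fun z => ev K (S z)).
Proof.
move=> hK [[d0 [r0 i0]] [d1 [r1 i1]] [d2 [r2 i2]] [d3 [r3 i3]]].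
pose S' z := HQ (d0 z) (d1 z) (d2 z) (d3 z).
have Hr : qC1_with U (fun z => qre (S z)) (fun z => qre (S' z))
    (fun z => - qim (S' z)).
  apply: qC1_with_comp; apply: ord4_ind.
  - by apply: (C1_with_eq oU _ r0) => z _; rewrite qoppE !mkquatE.
  - by apply: (C1_with_eq oU _ r1) => z _; rewrite qoppE !mkquatE.
  - by apply: (C1_with_eq oU _ r2) => z _; rewrite qoppE !mkquatE.
  - by apply: (C1_with_eq oU _ r3) => z _; rewrite qoppE !mkquatE.
have Hi : qC1_with U (fun z => qim (S z)) (fun z => qim (S' z))
    (fun z => qre (S' z)).
  apply: qC1_with_comp; apply: ord4_ind.
  - by apply: (C1_with_eq oU _ i0) => z _; rewrite !mkquatE.
  - by apply: (C1_with_eq oU _ i1) => z _; rewrite !mkquatE.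
  - by apply: (C1_with_eq oU _ i2) => z _; rewrite !mkquatE.
  - by apply: (C1_with_eq oU _ i3) => z _; rewrite !mkquatE.
apply: (qC1_with_holomorphic (p := fun z => ev K (S' z)) hK) => r.
apply: (C1_with_eq oU _ (C1_withD (Hr r) (Hi (qconj K * r)))) => z _.
rewrite /ev mulrDr mulrA imag_sqr// mulN1r !qdotDl -!qdotMl.
by split => //; rewrite addrC.
Qed.

Lemma holomorphic_eq K phi psi : (forall z, U z -> phi z = psi z) ->
  imag_unit K -> holomorphic K U phi -> holomorphic K U psi.
Proof.
move=> E hK /(holomorphic_qC1_with hK) H.
apply: (qC1_with_holomorphic (p := 'D_(1, 0) phi) hK) => r.
by apply: (C1_with_eq oU _ (H r)) => z Uz; rewrite E.
Qed.

End quaternionic_C1.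

Definition imnorm (R : realType) (q : quat R) : R :=
  Num.sqrt (q 0 1 ^+ 2 + q 0 2 ^+ 2 + q 0 3 ^+ 2).

(* At a real point [q] the inverse is [0^-1 = 0]; the value is then the real
   part of [S], which is the right one because [S] is real on the real axis. *)
Definition stem_fun (R : realType) (S : R * R -> hq R[i]) (q : quat R) : quat R :=
  ev ((imnorm q)^-1 *: (q - (q 0 0)%:A)) (S (q 0 0, imnorm q)).

Definition stem_domain (R : realType) (D : set (R * R)) :=
  [/\ open D, connected D, forall z, D z -> D (bar z) & exists x, D (x, 0)].

Definition axial (R : realType) (U : set (quat R)) (D : set (R * R)) :=
  forall K, imag_unit K -> slice U K = D.

Definition stem (R : realType) (D : set (R * R)) (S : R * R -> hq R[i]) :=
  hqhol D S /\ forall z, D z -> S (bar z) = hbar (S z).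

Section stems.
Context {R : realType}.
Implicit Types (D : set (R * R)) (U : set (quat R)) (S T : R * R -> hq R[i]).
Implicit Types (I J K q : quat R) (z : R * R).

Lemma hbar_real_ev K K' (X : hq R[i]) : X = hbar X -> ev K X = ev K' X.
Proof.
move=> hX; have : qim X = 0.
  have E : qim X = - qim X by rewrite {1}hX qim_hbar.
  apply/rowP => i; have := congr1 (fun q : quat R => q 0 i) E; rewrite qoppE => h.
  by rewrite [RHS]mxE; lra.
by rewrite /ev => ->; rewrite !mulr0.
Qed.

Lemma hbar_hc (c : R[i]) : hbar (hc c) = hc (conjc c).
Proof.
have c0 : conjc 0 = 0 :> R[i] by rewrite rmorph0.
by rewrite /hbar /hc; congr HQ; exact: c0.
Qed.

Lemma hbarM (X Y : hq R[i]) : hbar (X * Y) = hbar X * hbar Y.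
Proof.
apply: hq_ext; first by rewrite qre_hbar !qreM !qre_hbar !qim_hbar mulrNN.
by rewrite qim_hbar !qimM !qre_hbar !qim_hbar opprD mulrN mulNr.
Qed.

Lemma hbar_hconj (X : hq R[i]) : hbar (hconj X) = hconj (hbar X).
Proof.
apply: hq_ext; first by rewrite qre_hbar !qre_hconj qre_hbar.
by rewrite qim_hbar !qim_hconj qim_hbar qconjN.
Qed.

Lemma imnorm_qpoint K z : imag_unit K -> imnorm (qpoint K z) = `|z.2|.
Proof.
move=> /imag_unitP[K0 K1]; rewrite /imnorm /qpoint qoneE.
rewrite !(qaddE, qscaleE, mkquatE) !mulr0 !add0r !exprMn -!mulrDr K1 mulr1.
exact: sqrtr_sqr.
Qed.

Lemma re_qpoint K z : imag_unit K -> (qpoint K z) 0 0 = z.1.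
Proof.
move=> /imag_unitP[K0 K1]; rewrite /qpoint qoneE.
by rewrite !(qaddE, qscaleE, mkquatE) K0 mulr0 mulr1 addr0.
Qed.

(** A real [q] has no direction of its own; [K0] supplies one. *)
Lemma qpoint_surj (q K0 : quat R) : imag_unit K0 ->
  exists K z, imag_unit K /\ q = qpoint K z.
Proof.
move=> hK0; have [m0|m0] := eqVneq (imnorm q) 0.
  exists K0, (q 0 0, 0); split=> //; rewrite qpoint_real.
  move/eqP: m0; rewrite sqrtr_eq0 => m0.
  have sq0 (x : R) : x ^+ 2 = 0 -> x = 0 by move=> /eqP; rewrite sqrf_eq0 => /eqP.
  by apply: quatP; rewrite qoneE !(qscaleE, mkquatE) ?mulr1// mulr0;
    apply: sq0; nra.
exists ((imnorm q)^-1 *: (q - (q 0 0)%:A)), (q 0 0, imnorm q); split; last first.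
  by rewrite /qpoint /= scalerA mulfV// scale1r addrC subrK.
have m2 : q 0 1 ^+ 2 + q 0 2 ^+ 2 + q 0 3 ^+ 2 = imnorm q ^+ 2.
  by rewrite sqr_sqrtr// !addr_ge0// sqr_ge0.
rewrite /imag_unit /= expr2 -scalerAl -scalerAr scalerA.
have -> : (q - (q 0 0)%:A) * (q - (q 0 0)%:A) = - (imnorm q ^+ 2)%:A.
  rewrite -m2; apply: quatP;
  by rewrite qmulE qoppE qscaleE /qmul qoneE !mkquatE !(qaddE, qoppE, qscaleE, mkquatE); ring.
by rewrite scalerN scalerA -expr2 -exprMn mulVf// expr1n scale1r.
Qed.

(** Below the real axis [stem_fun] sees the unit [- K] and the point [bar z]; the symmetry of the
    stem undoes both changes. *)
Lemma stem_funE D S K z : (forall z, D z -> S (bar z) = hbar (S z)) ->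
  imag_unit K -> D z -> stem_fun S (qpoint K z) = ev K (S z).
Proof.
move=> symS hK Dz; rewrite /stem_fun imnorm_qpoint// re_qpoint//.
have -> : qpoint K z - z.1%:A = z.2 *: K by rewrite /qpoint addrC addKr.
case: z Dz => x y /= Dz; have [y0|y0|y0] := ltgtP y 0.
- rewrite ltr0_norm// -[(x, - y)]/(bar (x, y)) symS// ev_hbar scalerA.
  by rewrite invrN mulNr mulVf ?lt_eqF// scaleN1r opprK.
- by rewrite gtr0_norm// scalerA mulVf ?gt_eqF// scale1r.
rewrite y0 normr0; apply: hbar_real_ev; rewrite -symS /bar /= ?oppr0//.
by rewrite -y0.
Qed.

Lemma stem_fun_regular U D S : open D -> axial U D -> stem D S ->
  regular U (stem_fun S).
Proof.
move=> oD axU [hS symS] K hK; rewrite (axU K hK).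
apply: (holomorphic_eq oD _ hK (hqhol_holomorphic oD hK hS)) => z Dz /=.
by rewrite (stem_funE symS).
Qed.

(** All slices share the real axis. Agreement on one slice gives agreement there, and
    [hol_real_axis] carries it into every other slice. *)
Lemma regular_unique U D I f g : stem_domain D -> axial U D -> imag_unit I ->
  regular U f -> regular U g ->
  (forall z, D z -> f (qpoint I z) = g (qpoint I z)) ->
  forall K z, imag_unit K -> D z -> f (qpoint K z) = g (qpoint K z).
Proof.
move=> [oD cD _ [x0 Dx0]] axU hI rf rg fgI K z hK Dz.
have hf := rf K hK; have hg := rg K hK; rewrite (axU K hK) in hf hg.
apply/rowP => i; apply/eqP; rewrite -subr_eq0 -!qdot_qbasis; apply/eqP.
have Hf := holomorphic_hol oD (qbasis R i) hK hf.
have Hg := holomorphic_hol oD (qbasis R i) hK hg.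
suff /(congr1 (fun k : R[i] => Re k)) :
    (qdot (f (qpoint K z)) (qbasis R i) +i*
     qdot (f (qpoint K z)) (K * qbasis R i))%C -
    (qdot (g (qpoint K z)) (qbasis R i) +i*
     qdot (g (qpoint K z)) (K * qbasis R i))%C = 0 by [].
apply: (hol_real_axis oD cD (holB oD Hf Hg) Dx0 _ Dz) => x Dx.
by have := fgI _ Dx; rewrite /= !qpoint_real => ->; rewrite subrr.
Qed.

(** [stem_fun S] shows that the set inside [ext] is inhabited, and uniqueness identifies the chosen
    element with it. *)
Lemma extE U D I S phi : stem_domain D -> axial U D -> imag_unit I ->
  stem D S -> (forall z, D z -> phi z = ev I (S z)) ->
  forall K z, imag_unit K -> D z -> ext U I phi (qpoint K z) = ev K (S z).
Proof.
move=> dD axU hI sS phiE K z hK Dz.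
have [oD _ _ _] := dD; have [_ symS] := sS.
have rS := stem_fun_regular oD axU sS.
pose P := [set h | regular U h /\ forall z, slice U I z -> h (qpoint I z) = phi z].
have PS : P (stem_fun S).
  by split=> // w; rewrite (axU I hI) => Dw; rewrite phiE// (stem_funE symS).
have [re eE] : P (ext U I phi) by exact: (xgetI (fun=> 0) PS).
rewrite -(stem_funE symS hK Dz).
apply: (regular_unique dD axU hI re rS) => // w Dw.
by rewrite (stem_funE symS hI Dw) eE ?phiE// (axU I hI).
Qed.

(** * Star products, conjugates and stems of regular functions *)

Section products.
Variables (U : set (quat R)) (D : set (R * R)) (I J : quat R).
Hypotheses (dD : stem_domain D) (axU : axial U D).
Hypotheses (hI : imag_unit I) (hJ : imag_unit J) (hIJ : qdot I J = 0).

Lemma stemM S T : stem D S -> stem D T -> stem D (fun z => S z * T z).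
Proof.
move=> [[S0 S1 S2 S3] symS] [[T0 T1 T2 T3] symT]; have [oD _ _ _] := dD.
split; last by move=> z Dz; rewrite symS// symT// hbarM.
split=> /=.
- by apply: holB => //; [apply: holB => //; [apply: holB => //|]|]; exact: holM.
- by apply: holB => //; [apply: holD => //; [apply: holD => //|]|]; exact: holM.
- by apply: holD => //; [apply: holD => //; [apply: holB => //|]|]; exact: holM.
- by apply: holD => //; [apply: holB => //; [apply: holD => //|]|]; exact: holM.
Qed.

Lemma stem_conj S : stem D S -> stem D (fun z => hconj (S z)).
Proof.
move=> [[S0 S1 S2 S3] symS]; have [oD _ _ _] := dD.
split; last by move=> z Dz; rewrite symS// hbar_hconj.
by split => //=; exact: holN.
Qed.

Lemma starE S T f g : stem D S -> stem D T ->
  (forall z, D z -> f (qpoint I z) = ev I (S z)) ->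
  (forall z, D z -> g (qpoint I z) = ev I (T z)) ->
  forall K z, imag_unit K -> D z ->
    star I J U f g (qpoint K z) = ev K (S z * T z).
Proof.
move=> sS sT fE gE; apply: (extE dD axU hI (stemM sS sT)) => z Dz.
have [_ _ symD _] := dD; have [_ symT] := sT.
rewrite -[(z.1, - z.2)]/(bar z) !fE// !gE//; last exact: symD.
by rewrite (symT z Dz) (star_identity hI hJ hIJ).
Qed.

Lemma conjugateE S f : stem D S ->
  (forall z, D z -> f (qpoint I z) = ev I (S z)) ->
  forall K z, imag_unit K -> D z ->
    conjugate I J U f (qpoint K z) = ev K (hconj (S z)).
Proof.
move=> sS fE; apply: (extE dD axU hI (stem_conj sS)) => z Dz.
have [_ _ symD _] := dD; have [_ symS] := sS.
rewrite -[(z.1, - z.2)]/(bar z) !fE//; last exact: symD.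
by rewrite (symS z Dz) (conjugate_identity hI hJ hIJ).
Qed.

Lemma symmetrizationE S f : stem D S ->
  (forall z, D z -> f (qpoint I z) = ev I (S z)) ->
  forall K z, imag_unit K -> D z ->
    symmetrization I J U f (qpoint K z) = emb K (hnorm (S z)).
Proof.
move=> sS fE K z hK Dz.
rewrite /symmetrization (starE sS (stem_conj sS) fE _ hK Dz); first by rewrite hmul_conj ev_hc.
by move=> w Dw; exact: conjugateE.
Qed.

(** The representation formula: on the slice of [I] the even part of [f] in [y] is the real part of
    the stem, and the odd part is [I] times its imaginary part. Uniqueness then propagates the
    equality to the other slices. *)
Lemma regular_stem f : regular U f ->
  exists2 S, stem D S &
    forall K z, imag_unit K -> D z -> f (qpoint K z) = ev K (S z).
Proof.
move=> rf; have [oD _ symD _] := dD.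
have hf := rf I hI; rewrite (axU hI) in hf.
pose c (r : quat R) (z : R * R) : R[i] :=
  (qdot (f (qpoint I z)) r +i* qdot (f (qpoint I z)) (I * r))%C.
have Hc r : hol D (c r) by exact: (holomorphic_hol oD r hI hf).
(* Averaging a component with its Schwarz reflection keeps it holomorphic and makes it symmetric
   under [bar]. *)
pose s (i : 'I_4) z : R[i] :=
  (2^-1 +i* 0)%C * (c (qbasis R i) z + conjc (c (qbasis R i) (bar z))).
have Hs i : hol D (s i).
  apply: holM => //; first exact: hol_cst.
  by apply: holD => //; exact: hol_bar.
have symS i z : s i (bar z) = conjc (s i z).
  by rewrite /s barK; case: (c _ _) (c _ _) => [a b] [a' b'];
    apply: complex_ext => /=; ring.
pose S z := HQ (s 0 z) (s 1 z) (s 2 z) (s 3 z).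
have sS : stem D S.
  split; first by split; exact: Hs.
  by move=> z Dz; congr HQ; exact: symS.
have SE z : D z -> f (qpoint I z) = ev I (S z).
  move=> Dz.
  have hre : qre (S z) = 2^-1 *: (f (qpoint I z) + f (qpoint I (bar z))).
    have E i : Re (s i z) =
        (2^-1 *: (f (qpoint I z) + f (qpoint I (bar z)))) 0 i.
      by rewrite qscaleE qaddE /s Re_mulc Re_addc /= mul0r subr0 !qdot_qbasis.
    by apply: quatP; rewrite -E mkquatE.
  have him : qim (S z) = - (2^-1 *: (I * (f (qpoint I z) - f (qpoint I (bar z))))).
    have E i : Im (s i z) =
        (- (2^-1 *: (I * (f (qpoint I z) - f (qpoint I (bar z)))))) 0 i.
      rewrite qoppE qscaleE /s Im_mulc Im_addc /= mul0r addr0.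
      rewrite [in RHS]mulrBr qaddE qoppE -!qdot_qbasis !qdotMl (imag_conj hI) !mulNr !qdotNr.
      by ring.
    by apply: quatP; rewrite -E mkquatE.
  rewrite /ev hre him mulrN -scalerAr mulrA (imag_sqr hI) mulN1r scalerN opprK.
  rewrite -scalerDr addrACA subrr addr0 -mulr2n.
  by rewrite -(scaler_nat 2 (f (qpoint I z))) scalerA mulVf ?scale1r//.
exists S => // K z hK Dz.
rewrite -(stem_funE sS.2 hK Dz).
apply: (regular_unique dD axU hI rf (stem_fun_regular oD axU sS)) => // w Dw.
by rewrite (stem_funE sS.2 hI Dw) SE.
Qed.

End products.

End stems.

(** * The ring of slice preserving functions *)

(** The proof is bundled with the set because the ring structures on [sfun], attached to the type
    alone, depend on it. *)
Record sdom (R : realType) :=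
  SDom { sdom_set : set (R * R); sdomP : stem_domain sdom_set }.

Definition sfun_spec (R : realType) (D : set (R * R)) (c : R * R -> R[i]) :=
  [/\ hol D c, forall z, D z -> c (bar z) = conjc (c z) &
      forall z, ~ D z -> c z = 0].

(* Slice preserving regular functions, given by their complex stem; setting the
   stem to 0 off [D] makes equality of stems extensional. *)
Record sfun (R : realType) (D : sdom R) :=
  SFun { sfun_val :> R * R -> R[i]; sfunP : sfun_spec (sdom_set D) sfun_val }.

HB.instance Definition _ (R : realType) (D : sdom R) := gen_eqMixin (sfun D).
HB.instance Definition _ (R : realType) (D : sdom R) := gen_choiceMixin (sfun D).

Lemma sfun_ext (R : realType) (D : sdom R) (f g : sfun D) :
  (forall z, sdom_set D z -> f z = g z) -> f = g.
Proof.
move=> fg; have E : sfun_val f = sfun_val g.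
  apply/funext => z; have [/fg//|Dz] := pselect (sdom_set D z).
  by have [_ _ hf] := sfunP f; have [_ _ hg] := sfunP g; rewrite hf// hg.
case: f g E {fg} => [f Hf] [g Hg] /= E; rewrite E in Hf *.
by congr SFun; exact: Prop_irrelevance.
Qed.

Section sfun_ring.
Context {R : realType} (Dm : sdom R).
Local Notation D := (sdom_set Dm).
Implicit Types (f g h : sfun Dm) (X Y : hq (sfun Dm)).

Let oD : open D. Proof. by have [] := sdomP Dm. Qed.
Let cD : connected D. Proof. by have [] := sdomP Dm. Qed.

Lemma sfun_holP f : hol D f. Proof. by have [] := sfunP f. Qed.
Lemma sfun_bar f z : D z -> f (bar z) = conjc (f z).
Proof. by have [_ + _] := sfunP f; apply. Qed.
Lemma sfun_out f z : ~ D z -> f z = 0.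
Proof. by have [_ _] := sfunP f; apply. Qed.

Lemma sfun_zero_spec : sfun_spec D (fun=> 0).
Proof. by split => // [|z _]; [exact: hol_cst|rewrite rmorph0]. Qed.
Definition sfun_zero := SFun sfun_zero_spec.

Lemma sfun_one_spec : sfun_spec D (restrict0 D (fun=> 1)).
Proof.
have [_ _ symD _] := sdomP Dm; split.
- by apply: (hol_eq oD _ (hol_cst oD 1)) => z Dz; rewrite /restrict0 asboolT.
- by move=> z Dz; rewrite /restrict0 !asboolT ?rmorph1//; exact: symD.
- by move=> z Dz; rewrite /restrict0 asboolF.
Qed.
Definition sfun_one := SFun sfun_one_spec.

Lemma sfun_opp_spec f : sfun_spec D (fun z => - f z).
Proof.
split; first exact: holN (sfun_holP f).
- by move=> z Dz; rewrite sfun_bar// rmorphN.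
- by move=> z Dz; rewrite sfun_out// oppr0.
Qed.
Definition sfun_opp f := SFun (sfun_opp_spec f).

Lemma sfun_add_spec f g : sfun_spec D (fun z => f z + g z).
Proof.
split; first exact: holD (sfun_holP f) (sfun_holP g).
- by move=> z Dz; rewrite !sfun_bar// rmorphD.
- by move=> z Dz; rewrite !sfun_out// addr0.
Qed.
Definition sfun_add f g := SFun (sfun_add_spec f g).

Lemma sfun_mul_spec f g : sfun_spec D (fun z => f z * g z).
Proof.
split; first exact: holM (sfun_holP f) (sfun_holP g).
- by move=> z Dz; rewrite !sfun_bar// rmorphM.
- by move=> z Dz; rewrite !sfun_out// mulr0.
Qed.
Definition sfun_mul f g := SFun (sfun_mul_spec f g).

Lemma sfun_addA : associative sfun_add.
Proof. by move=> f g h; apply: sfun_ext => z _ /=; rewrite addrA. Qed.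
Lemma sfun_addC : commutative sfun_add.
Proof. by move=> f g; apply: sfun_ext => z _ /=; rewrite addrC. Qed.
Lemma sfun_add0 : left_id sfun_zero sfun_add.
Proof. by move=> f; apply: sfun_ext => z _ /=; rewrite add0r. Qed.
Lemma sfun_addN : left_inverse sfun_zero sfun_opp sfun_add.
Proof. by move=> f; apply: sfun_ext => z _ /=; rewrite addNr. Qed.

HB.instance Definition _ :=
  GRing.isZmodule.Build (sfun Dm) sfun_addA sfun_addC sfun_add0 sfun_addN.

Lemma sfun_mulA : associative sfun_mul.
Proof. by move=> f g h; apply: sfun_ext => z _ /=; rewrite mulrA. Qed.
Lemma sfun_mulC : commutative sfun_mul.
Proof. by move=> f g; apply: sfun_ext => z _ /=; rewrite mulrC. Qed.
Lemma sfun_mul1 : left_id sfun_one sfun_mul.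
Proof.
by move=> f; apply: sfun_ext => z Dz /=; rewrite /restrict0 asboolT ?mul1r.
Qed.
Lemma sfun_mulDl : left_distributive sfun_mul sfun_add.
Proof. by move=> f g h; apply: sfun_ext => z _ /=; rewrite mulrDl. Qed.
Lemma sfun_one_neq0 : sfun_one != sfun_zero.
Proof.
have [_ _ _ [x Dx]] := sdomP Dm.
apply/eqP => /(congr1 (fun f : sfun Dm => f (x, 0))) /eqP.
by rewrite /= /restrict0 asboolT// oner_eq0.
Qed.

HB.instance Definition _ := GRing.Zmodule_isComNzRing.Build (sfun Dm)
  sfun_mulA sfun_mulC sfun_mul1 sfun_mulDl sfun_one_neq0.

Definition sfun_unit : pred (sfun Dm) := [pred f | `[< exists g, g * f = 1 >]].
Definition sfun_inv f : sfun Dm :=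
  if pselect (exists g, g * f = 1) is left h then sval (cid h) else f.

Lemma sfun_mulV : {in sfun_unit, left_inverse 1 sfun_inv *%R}.
Proof.
move=> f /asboolP h; rewrite /sfun_inv.
by case: pselect => // h'; case: (cid h').
Qed.
Lemma sfun_unitP f g : g * f = 1 -> f \in sfun_unit.
Proof. by move=> h; apply/asboolP; exists g. Qed.
Lemma sfun_inv_out : {in [predC sfun_unit], sfun_inv =1 id}.
Proof.
move=> f /negP nf; rewrite /sfun_inv.
by case: pselect => // h; case: nf; apply/asboolP.
Qed.

HB.instance Definition _ := GRing.ComNzRing_hasMulInverse.Build (sfun Dm)
  sfun_mulV sfun_unitP sfun_inv_out.

Lemma sfun_neq0P f : f != 0 -> exists z, D z /\ f z != 0.
Proof.
move=> f0; apply: contrapT => H; move/eqP: f0; apply.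
apply: sfun_ext => z Dz /=; apply/eqP; apply: contrapT => fz.
by apply: H; exists z; split => //; apply/negP.
Qed.

Lemma sfun_integral : GRing.integral_domain_axiom (sfun Dm).
Proof.
move=> f g fg0; have [//|f0 /=] := eqVneq f 0; apply/eqP.
have [z [Dz fz]] := sfun_neq0P f0; apply: sfun_ext => w Dw.
apply: (hol_identity oD (sfun_holP g) cD Dz) => //.
apply: filterS (hol_near_neq0 oD (sfun_holP f) Dz fz) => x fx.
have /eqP : f x * g x = 0 by rewrite -[LHS]/((f * g) x) fg0.
by rewrite mulf_eq0 (negbTE fx) => /eqP.
Qed.

HB.instance Definition _ :=
  GRing.ComUnitRing_isIntegral.Build (sfun Dm) sfun_integral.

Lemma sfun_real_eq0 f : (forall x, D (x, 0) -> f (x, 0) = 0) -> f = 0.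
Proof.
move=> H; have [_ _ _ [x0 Dx0]] := sdomP Dm; apply: sfun_ext => z Dz /=.
exact: (hol_real_axis oD cD (sfun_holP f) Dx0 H).
Qed.

Lemma sfun_sum4sq : sum4sq_free (sfun Dm).
Proof.
move=> a b c d H.
have real f x : D (x, 0) -> Im (f (x, 0)) = 0.
  move=> Dx; have := sfun_bar f Dx.
  rewrite /bar /= oppr0; case: (f _) => u v [] /=; lra.
have E x : D (x, 0) ->
    [/\ a (x, 0) = 0, b (x, 0) = 0, c (x, 0) = 0 & d (x, 0) = 0].
  move=> Dx; have := real a _ Dx; have := real b _ Dx.
  have := real c _ Dx; have := real d _ Dx.
  have : Re ((a * a + b * b + c * c + d * d) (x, 0)) = 0 by rewrite H.
  rewrite /= !Re_addc !Re_mulc => s d0 c0 b0 a0.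
  rewrite a0 b0 c0 d0 in s.
  have Z (u : R[i]) : Re u ^+ 2 = 0 -> Im u = 0 -> u = 0.
    by move=> /eqP; rewrite sqrf_eq0 => /eqP h1 h2; exact: complex_ext.
  by split; apply: Z => //; nra.
by split; apply: sfun_real_eq0 => x /E[].
Qed.

(** Compatible with sums and products by computation; only the unit, which is 0 off [D], needs [z]
    in [D]. *)
Definition hev (z : R * R) (X : hq (sfun Dm)) : hq R[i] :=
  HQ (h0 X z) (h1 X z) (h2 X z) (h3 X z).

Lemma hevM z X Y : hev z (X * Y) = hev z X * hev z Y.
Proof. by []. Qed.
Lemma hevD z X Y : hev z (X + Y) = hev z X + hev z Y.
Proof. by []. Qed.
Lemma hevN z X : hev z (- X) = - hev z X.
Proof. by []. Qed.
Lemma hev_hc z f : hev z (hc f) = hc (f z).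
Proof. by []. Qed.
Lemma sfun1E z : D z -> (1 : sfun Dm) z = 1.
Proof. by move=> Dz; rewrite /= /restrict0 asboolT. Qed.
Lemma hev1 z : D z -> hev z 1 = 1.
Proof. by move=> Dz; rewrite /hev /= /restrict0 asboolT. Qed.

Lemma hev_ext X Y : (forall z, D z -> hev z X = hev z Y) -> X = Y.
Proof.
case: X Y => [a b c d] [a' b' c' d'] H.
by congr HQ; apply: sfun_ext => z /H[].
Qed.

Lemma hev_stem X : stem D (hev ^~ X).
Proof.
split; first by split; exact: sfun_holP.
by move=> z Dz; congr HQ; exact: sfun_bar.
Qed.

Lemma stem_hev S : stem D S -> exists X, forall z, D z -> hev z X = S z.
Proof.
move=> [[H0 H1 H2 H3] symS].
have mk c : hol D c -> (forall z, D z -> c (bar z) = conjc (c z)) ->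
    exists f : sfun Dm, forall z, D z -> f z = c z.
  move=> Hc symc; have [_ _ symD _] := sdomP Dm.
  have Hs : sfun_spec D (restrict0 D c).
    split.
    - by apply: (hol_eq oD _ Hc) => z Dz; rewrite /restrict0 asboolT.
    - by move=> z Dz; rewrite /restrict0 !asboolT ?symc//; exact: symD.
    - by move=> z Dz; rewrite /restrict0 asboolF.
  by exists (SFun Hs) => z Dz; rewrite /= /restrict0 asboolT.
have [||f0 E0] := mk (fun z => h0 (S z)) => //; first by move=> z /symS ->.
have [||f1 E1] := mk (fun z => h1 (S z)) => //; first by move=> z /symS ->.
have [||f2 E2] := mk (fun z => h2 (S z)) => //; first by move=> z /symS ->.
have [||f3 E3] := mk (fun z => h3 (S z)) => //; first by move=> z /symS ->.
exists (HQ f0 f1 f2 f3) => z Dz.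
by rewrite /hev /= E0// E1// E2// E3//; case: (S z).
Qed.

(** Real points survive because a [w] vanishing on the whole real axis of [D] would be 0. *)
Lemma sfun_nonzero_domain (w : sfun Dm) : w != 0 ->
  stem_domain (D `&` [set z | w z != 0]).
Proof.
move=> w0; have [_ _ symD _] := sdomP Dm; split.
- exact: open_hol_neq0 (sfun_holP w).
- exact: connected_hol_neq0 (sfun_holP w).
- move=> z [Dz wz]; split; first exact: symD.
  by rewrite /= sfun_bar// fmorph_eq0.
- apply: contrapT => H; move/eqP: w0; apply; apply: sfun_real_eq0 => x Dx.
  by apply/eqP; apply: contrapT => wx; apply: H; exists x; split => //; apply/negP.
Qed.

(** Multiplying by [w] kills the difference at the excluded points; absence of zero divisors then
    removes the factor, with no density argument. *)
Lemma hev_nonzero_ext (w : sfun Dm) X Y : w != 0 ->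
  (forall z, D z -> w z != 0 -> hev z X = hev z Y) -> X = Y.
Proof.
move=> w0 H; have W0 : hc w != 0 by rewrite hc_eq0.
have : hc w * (X - Y) = 0.
  apply: hev_ext => z Dz; rewrite hevM hevD hevN hev_hc.
  have [->|wz] := eqVneq (w z) 0; first by rewrite hc0 mul0r.
  by rewrite H// subrr mulr0.
move/(hq_integral sfun_sum4sq); rewrite (negbTE W0) /= subr_eq0.
by move/eqP.
Qed.

End sfun_ring.

(** * Fractions and partial functions *)

Definition hfrac (T : idomainType) (K : fieldType) (f : {rmorphism T -> K})
    (n : T) (X : hq T) : hq K := hc (f n)^-1 * hmap f X.

Section fractions.
Variables (T : idomainType) (K : fieldType) (f : {rmorphism T -> K}).
Hypothesis f_inj : injective f.
Implicit Types (n m k w : T) (X Y Z W : hq T).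

Let f_neq0 n : n != 0 -> f n != 0.
Proof. by rewrite -(inj_eq f_inj) rmorph0. Qed.

Let hcK n : n != 0 -> hc (f n) * hc (f n)^-1 = 1.
Proof. by move=> n0; rewrite -hcM mulfV ?f_neq0. Qed.

Let hc_unit n : n != 0 -> hc (f n) \is a GRing.unit.
Proof. by move=> n0; rewrite hq_unitE hnorm_hc mulf_neq0 ?f_neq0. Qed.

Lemma hc_hfrac n X : n != 0 -> hc (f n) * hfrac f n X = hmap f X.
Proof. by move=> n0; rewrite /hfrac mulrA hcK// mul1r. Qed.

Lemma hfrac_eq k Z w W : k != 0 -> w != 0 ->
  hfrac f k Z = hfrac f w W <-> hc w * Z = hc k * W.
Proof.
move=> k0 w0.
have E : hc (f (k * w)) * hfrac f k Z = hmap f (hc w * Z).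
  by rewrite [k * w]mulrC rmorphM hcM -mulrA hc_hfrac// rmorphM /= hmap_hc.
have F : hc (f (k * w)) * hfrac f w W = hmap f (hc k * W).
  by rewrite rmorphM hcM -mulrA hc_hfrac// rmorphM /= hmap_hc.
split=> [h|h]; first by apply: (hmap_inj f_inj); rewrite -E -F h.
have u : hc (f (k * w)) \is a GRing.unit by rewrite hc_unit// mulf_neq0.
by apply: (mulrI u); rewrite E F h.
Qed.

Lemma hfracD n X m Y : n != 0 -> m != 0 ->
  hfrac f n X + hfrac f m Y = hfrac f (n * m) (hc m * X + hc n * Y).
Proof.
move=> n0 m0; have u : hc (f (n * m)) \is a GRing.unit by rewrite hc_unit// mulf_neq0.
apply: (mulrI u); rewrite hc_hfrac ?mulf_neq0// mulrDr.
rewrite {1}mulrC !rmorphM !hcM -!mulrA !hc_hfrac// rmorphD /= !rmorphM /=.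
by rewrite !hmap_hc.
Qed.

Lemma hfracM n X m Y :
  hfrac f n X * hfrac f m Y = hfrac f (n * m) (X * Y).
Proof.
rewrite /hfrac !rmorphM /= invfM hcM.
by rewrite -!mulrA; congr (_ * _); rewrite !mulrA hc_comm.
Qed.

Lemma hfrac1 X : hfrac f 1 X = hmap f X.
Proof. by rewrite /hfrac rmorph1 invr1 hc1 mul1r. Qed.

End fractions.

Section representation.
Context {R : realType} (Dm : sdom R).
Local Notation D := (sdom_set Dm).
Variables (I J : quat R).
Hypotheses (hI : imag_unit I) (hJ : imag_unit J) (hIJ : qdot I J = 0).
Implicit Types (n m k w : sfun Dm) (X Y Z W F G : hq (sfun Dm)) (p q r : pfun R).

Definition value n X (z : R * R) : hq R[i] := hc (n z)^-1 * hev z X.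

(** The denominator is not reduced: its zeros are exactly the points of the slice missing from the
    domain of [p], removable singularities included. *)
Definition represents p n X :=
  [/\ n != 0,
      forall K z, imag_unit K -> dom p (qpoint K z) <-> D z /\ n z != 0
    & forall K z, imag_unit K -> D z -> n z != 0 ->
        fn p (qpoint K z) = ev K (value n X z)].

(** Equal values for the units [I] and [- I] give equal stems wherever [k * w] is nonzero, and
    [hev_nonzero_ext] extends the cross-multiplied equality to all of [D]. The relation thus becomes
    equality of fractions. *)
Lemma represents_coincide r k Z p w W : represents r k Z -> represents p w W ->
  coincide r p <-> hc w * Z = hc k * W.
Proof.
move=> [k0 domr rE] [w0 domp pE].
have hcz (c : R[i]) : c != 0 -> hc c * hc c^-1 = 1.
  by move=> c0; rewrite -hcM mulfV.
split=> [H|H x].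
  have kw0 : k * w != 0 by rewrite mulf_neq0.
  apply: (hev_nonzero_ext kw0) => z Dz.
  rewrite -[(k * w) z]/(k z * w z) mulf_eq0 negb_or => /andP[kz wz].
  have E K : imag_unit K -> ev K (value k Z z) = ev K (value w W z).
    move=> hK; rewrite -rE// -pE//; apply: H; split; first exact/domr.
    exact/domp.
  have {}E := ev_inj hI (E I hI) (E (- I) (imag_unitN hI)).
  have EZ : hev z Z = hc (k z) * value k Z z.
    by rewrite /value mulrA (hcz _ kz) mul1r.
  have EW : hev z W = hc (w z) * value w W z.
    by rewrite /value mulrA (hcz _ wz) mul1r.
  rewrite !hevM !hev_hc EZ EW E !mulrA.
  by rewrite -(hc_comm (w z)).
have [K [z [hK ->]]] := qpoint_surj x hI.
move=> [/(domr _ _ hK)[Dz kz] /(domp _ _ hK)[_ wz]]; rewrite rE// pE//.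
congr ev; have := congr1 (hev z) H; rewrite !hevM !hev_hc => Hz.
have EZ : hc (w z)^-1 * (hc (w z) * hev z Z) = hev z Z.
  by rewrite mulrA -hcM mulVf// hc1 mul1r.
have EW : hc (k z)^-1 * (hc (k z) * hev z W) = hev z W.
  by rewrite mulrA -hcM mulVf// hc1 mul1r.
by rewrite /value -EZ Hz mulrA -hcM mulrC hcM -mulrA EW.
Qed.

Lemma represents_unique p n X m Y : represents p n X -> represents p m Y ->
  hc m * X = hc n * Y.
Proof. by move=> H1 H2; apply/(represents_coincide H1 H2). Qed.

Lemma represents_psum p n X q m Y : represents p n X -> represents q m Y ->
  represents (psum p q) (n * m) (hc m * X + hc n * Y).
Proof.
move=> [n0 domp pE] [m0 domq qE]; split; first by rewrite mulf_neq0.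
- move=> K z hK; rewrite -[(n * m) z]/(n z * m z) mulf_eq0 negb_or.
  split.
    move=> [/(domp _ _ hK)[Dz nz] /(domq _ _ hK)[_ mz]].
    by split; rewrite ?nz ?mz.
  by move=> [Dz /andP[nz mz]]; split; [apply/domp|apply/domq].
- move=> K z hK Dz; rewrite -[(n * m) z]/(n z * m z) mulf_eq0 negb_or.
  move=> /andP[nz mz]; rewrite /= pE// qE// -evD; congr ev.
  rewrite /value -[(n * m) z]/(n z * m z) hevD !hevM !hev_hc mulrDr !mulrA -!hcM.
  by rewrite invfM mulfVK// [(n z)^-1 * _]mulrC mulfVK.
Qed.

Lemma stem_value n X : stem (D `&` [set z | n z != 0]) (value n X).
Proof.
have [oD _ symD _] := sdomP Dm.
have oD' := open_hol_neq0 oD (sfun_holP n).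
have sub : D `&` [set z | n z != 0] `<=` D by move=> z [].
have Hn : hol (D `&` [set z | n z != 0]) (fun z => (n z)^-1).
  by apply: (holV oD') => [z []//|]; exact: hol_sub (sfun_holP n).
have HX (f : sfun Dm) : hol (D `&` [set z | n z != 0]) (fun z => (n z)^-1 * f z).
  by apply: holM => //; exact: hol_sub (sfun_holP f).
split; last first.
  move=> z [Dz nz]; rewrite /value hbarM; congr (_ * _).
    by rewrite sfun_bar// hbar_hc fmorphV.
  by have [_ ->] := hev_stem X.
by split; apply: (hol_eq oD' _ (HX _)) => z _; rewrite /value /=; ring.
Qed.

(** The star product is taken anew on the common domain, whose slice is the nonvanishing set of
    [n * m] and hence again a stem domain; central denominators pass through the numerators. *)
Lemma represents_pprod p n X q m Y : represents p n X -> represents q m Y ->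
  represents (pprod I J p q) (n * m) (X * Y).
Proof.
move=> Hp Hq; have [n0 domp pE] := Hp; have [m0 domq qE] := Hq.
have [nm0 domS _] := represents_psum Hp Hq.
split => // K z hK Dz nmz.
have axU : axial (dom p `&` dom q) (D `&` [set z | (n * m) z != 0]).
  move=> K' hK'; rewrite eqEsubset; split=> y.
  - by move=> /(domS K' y hK').
  - by move=> h; exact/(domS K' y hK').
have sub (l : sfun Dm) : (forall y, (n * m) y != 0 -> l y != 0) ->
    forall S, stem (D `&` [set z | l z != 0]) S ->
    stem (D `&` [set z | (n * m) z != 0]) S.
  move=> hl S [[s0 s1 s2 s3] symS].
  have s : D `&` [set z | (n * m) z != 0] `<=` D `&` [set z | l z != 0].
    by move=> y [Dy /hl ly].
  split; first by split; exact: hol_sub s _.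
  by move=> y /s; exact: symS.
have nmE y : (n * m) y != 0 -> n y != 0 /\ m y != 0.
  by rewrite -[(n * m) y]/(n y * m y) mulf_eq0 negb_or => /andP.
have sX := sub n (fun y h => (nmE y h).1) _ (stem_value n X).
have sY := sub m (fun y h => (nmE y h).2) _ (stem_value m Y).
rewrite /= (starE (sfun_nonzero_domain nm0) axU hI hJ hIJ sX sY _ _ hK)//.
- congr ev; rewrite /value hevM -[(n * m) z]/(n z * m z) invfM hcM.
  by rewrite -!mulrA; congr (_ * _); rewrite !mulrA hc_comm.
- by move=> y [Dy /nmE[ny _]]; exact: pE.
- by move=> y [Dy /nmE[_ my]]; exact: qE.
Qed.

Section on_Omega.
Variable Omega : set (quat R).
Hypothesis axO : axial Omega D.

Lemma Omega_qpoint K z : imag_unit K -> Omega (qpoint K z) <-> D z.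
Proof. by move=> hK; rewrite -(axO hK). Qed.

Lemma regular_hev f : regular Omega f ->
  exists X, forall K z, imag_unit K -> D z -> f (qpoint K z) = ev K (hev z X).
Proof.
move=> rf; have [S sS SE] := regular_stem (sdomP Dm) axO hI rf.
have [X XE] := stem_hev sS; exists X => K z hK Dz.
by rewrite XE// SE.
Qed.

Lemma hev_regular X : exists2 f, regular Omega f &
  forall K z, imag_unit K -> D z -> f (qpoint K z) = ev K (hev z X).
Proof.
have [oD _ _ _] := sdomP Dm; have sS := hev_stem X.
exists (stem_fun (fun z => hev z X)); first exact: stem_fun_regular axO sS.
by move=> K z hK Dz; exact: (stem_funE sS.2 hK Dz).
Qed.

Lemma represents_regular f X :
  (forall K z, imag_unit K -> D z -> f (qpoint K z) = ev K (hev z X)) ->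
  represents (PFun Omega f) 1 X.
Proof.
move=> fE; have one_neq0 z : D z -> (1 : sfun Dm) z != 0.
  by move=> Dz; rewrite sfun1E ?oner_eq0.
split; first exact: oner_neq0.
- move=> K z hK; rewrite /= (Omega_qpoint z hK); split=> [Dz|[]//].
  by split => //; exact: one_neq0.
- by move=> K z hK Dz _; rewrite /= fE// /value sfun1E// invr1 hc1 mul1r.
Qed.

Lemma represents_quotient f g F G :
  (forall K z, imag_unit K -> D z -> f (qpoint K z) = ev K (hev z F)) ->
  (forall K z, imag_unit K -> D z -> g (qpoint K z) = ev K (hev z G)) ->
  hnorm F != 0 ->
  represents (quotient I J Omega f g) (hnorm F) (hconj F * G).
Proof.
move=> fE gE; set N := hnorm F; have NE z : N z = hnorm (hev z F) by [].
clearbody N => N0.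
have symE K z : imag_unit K -> D z ->
    symmetrization I J Omega f (qpoint K z) = emb K (N z).
  move=> hK Dz; rewrite (symmetrizationE (sdomP Dm) axO hI hJ hIJ (hev_stem F) _ hK) ?NE//.
  by move=> y Dy; exact: fE.
have domE K z : imag_unit K ->
    dom (quotient I J Omega f g) (qpoint K z) <-> D z /\ N z != 0.
  move=> hK; rewrite /quotient /zero_set /=.
  split=> [[/(Omega_qpoint z hK) Dz nz]|[Dz Nz]].
    split=> //; apply/eqP => Nz; apply: nz; split; first exact/(Omega_qpoint z hK).
    by rewrite symE// Nz emb0.
  have Oz : Omega (qpoint K z) by exact/(Omega_qpoint z hK).
  by split=> // -[_]; rewrite symE//; apply/eqP/emb_neq0.
split => // K z hK Dz Nz.
have axU : axial (Omega `\` zero_set Omega (symmetrization I J Omega f))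
    (D `&` [set z | N z != 0]).
  move=> K' hK'; rewrite eqEsubset; split=> y.
  - by move=> /(domE K' y hK').
  - by move=> h; exact/(domE K' y hK').
have sF := stem_value N (hconj F).
have sG : stem (D `&` [set z | N z != 0]) (fun z => hev z G).
  have [[s0 s1 s2 s3] symS] := hev_stem G.
  have s : D `&` [set z | N z != 0] `<=` D by move=> y [].
  split; first by split; exact: hol_sub s _.
  by move=> y /s; exact: symS.
rewrite /quotient /= (starE (sfun_nonzero_domain N0) axU hI hJ hIJ sF sG _ _ hK)//.
- by rewrite /value hevM mulrA.
- move=> y [Dy Ny]; rewrite /reciprocal symE// embV//.
  rewrite (conjugateE (sdomP Dm) axO hI hJ hIJ (hev_stem F) _ hI)//; last first.
    by move=> x Dx; exact: fE.
  by rewrite -ev_central// /value.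
- by move=> y [Dy _]; exact: gE.
Qed.

End on_Omega.

End representation.

(** * The two presented rings and the embedding between them *)

Section presentation.
Context {R : realType} (Dm : sdom R).
Local Notation D := (sdom_set Dm).
Variables (I J : quat R) (Omega : set (quat R)).
Hypotheses (hI : imag_unit I) (hJ : imag_unit J) (hIJ : qdot I J = 0).
Hypothesis axO : axial Omega D.
Variables (K : fieldType) (f : {rmorphism sfun Dm -> K}).
Hypothesis f_inj : injective f.
Hypothesis f_frac : forall r : K,
  exists n d : sfun Dm, d != 0 /\ r = f n / f d.
Implicit Types (p q r : pfun R) (n m k : sfun Dm) (X Y Z : hq (sfun Dm)).

(** The default 0 is taken only by partial functions without such a representation, on which
    [presents] places no condition. *)
Definition cls_regular p : hq (sfun Dm) :=
  xget 0 [set X | represents p 1 X].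

Definition cls_quotient p : hq K :=
  xget 0 [set l | exists n X, represents p n X /\ l = hfrac f n X].

Lemma cls_regularE p X : represents p 1 X -> cls_regular p = X.
Proof.
move=> pX; have pY : represents p 1 (cls_regular p).
  exact: (xgetI 0 (P := [set X | represents p 1 X]) pX).
by have := represents_unique hI pY pX; rewrite hc1 !mul1r.
Qed.

Lemma cls_quotientE p n X : represents p n X -> cls_quotient p = hfrac f n X.
Proof.
move=> pX.
have [m [Y [pY ->]]] : [set l | exists n X, represents p n X /\ l = hfrac f n X]
    (cls_quotient p) by apply: (xgetI 0 (x := hfrac f n X)); exists n, X.
have [n0 _ _] := pX; have [m0 _ _] := pY.
exact/(hfrac_eq f_inj _ _ m0 n0)/(represents_unique hI pY pX).
Qed.

Lemma regular_functions_represented p : regular_functions Omega p ->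
  exists X, represents p 1 X.
Proof.
case: p => U g [/= -> rg]; have [X gE] := regular_hev hI axO rg.
by exists X; exact: represents_regular.
Qed.

Lemma star_quotients_represented p : star_quotients I J Omega p ->
  exists n X, represents p n X.
Proof.
move=> [g [h [rg rh [q Oq gq] ->]]].
have [G gE] := regular_hev hI axO rg; have [H hE] := regular_hev hI axO rh.
exists (hnorm G), (hconj G * H); apply: represents_quotient => //.
apply: (hnorm_neq0 (@sfun_sum4sq _ Dm)); apply: contra_neq gq => G0.
have [L [z [hL qE]]] := qpoint_surj q hI; rewrite qE in Oq *.
have Dz : D z by apply/(Omega_qpoint axO z hL).
by rewrite gE// G0 -hc0 hev_hc ev_hc emb0.
Qed.

Lemma presents_regular_functions :
  presents I J (regular_functions Omega) cls_regular.
Proof.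
split.
- move=> X; have [g rg gE] := hev_regular axO X.
  exists (PFun Omega g); first by [].
  exact/cls_regularE/represents_regular.
- move=> p q /regular_functions_represented[X pX].
  move=> /regular_functions_represented[Y qY].
  rewrite (cls_regularE pX) (cls_regularE qY).
  have := represents_coincide hI pX qY; rewrite hc1 !mul1r => h.
  by split=> /h.
- move=> p q r /regular_functions_represented[X pX].
  move=> /regular_functions_represented[Y qY] /regular_functions_represented[Z rZ].
  rewrite (cls_regularE pX) (cls_regularE qY) (cls_regularE rZ).
  have := represents_coincide hI rZ (represents_psum pX qY).
  by rewrite !(mul1r, hc1) => h; split=> /h.
- move=> p q r /regular_functions_represented[X pX].
  move=> /regular_functions_represented[Y qY] /regular_functions_represented[Z rZ].
  rewrite (cls_regularE pX) (cls_regularE qY) (cls_regularE rZ).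
  have := represents_coincide hI rZ (represents_pprod hI hJ hIJ pX qY).
  by rewrite !(mul1r, hc1) => h; split=> /h.
Qed.

Lemma presents_star_quotients :
  presents I J (star_quotients I J Omega) cls_quotient.
Proof.
have neq0 p n X : represents p n X -> n != 0 by case.
split.
- move=> x; have [n [X [n0 xE]]] := hq_quotient_denominator f_inj f_frac x.
  (* A central denominator is its own conjugate and has norm [n * n], so the quotient is represented
     by [n * X] over [n * n], which is the required fraction after cancelling one [n]. *)
  have [g rg gE] := hev_regular axO (hc n); have [h rh hE] := hev_regular axO X.
  have N0 : hnorm (hc n) != 0 by rewrite hnorm_hc mulf_neq0.
  exists (quotient I J Omega g h).
    exists g, h; split => //; have [z [Dz nz]] := sfun_neq0P n0.
    exists (qpoint I z); first exact/(Omega_qpoint axO z hI).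
    by rewrite gE// hev_hc ev_hc emb_neq0.
  rewrite (cls_quotientE (represents_quotient hI hJ hIJ axO gE hE N0)) xE.
  apply/(hfrac_eq f_inj _ _ N0 n0); by rewrite hnorm_hc hcM -mulrA hconj_hc.
- move=> p q /star_quotients_represented[n [X pX]].
  move=> /star_quotients_represented[m [Y qY]].
  rewrite (cls_quotientE pX) (cls_quotientE qY).
  have h := represents_coincide hI pX qY.
  have h' := hfrac_eq f_inj X Y (neq0 _ _ _ pX) (neq0 _ _ _ qY).
  by split=> [/h'/h|/h/h'].
- move=> p q r /star_quotients_represented[n [X pX]].
  move=> /star_quotients_represented[m [Y qY]] /star_quotients_represented[k [Z rZ]].
  rewrite (cls_quotientE pX) (cls_quotientE qY) (cls_quotientE rZ).
  have s := represents_psum pX qY; have h := represents_coincide hI rZ s.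
  rewrite (hfracD f_inj _ _ (neq0 _ _ _ pX) (neq0 _ _ _ qY)).
  have h' := hfrac_eq f_inj Z (hc m * X + hc n * Y) (neq0 _ _ _ rZ) (neq0 _ _ _ s).
  by split=> [/h'/h|/h/h'].
- move=> p q r /star_quotients_represented[n [X pX]].
  move=> /star_quotients_represented[m [Y qY]] /star_quotients_represented[k [Z rZ]].
  rewrite (cls_quotientE pX) (cls_quotientE qY) (cls_quotientE rZ).
  have s := represents_pprod hI hJ hIJ pX qY; have h := represents_coincide hI rZ s.
  rewrite hfracM.
  have h' := hfrac_eq f_inj Z (X * Y) (neq0 _ _ _ rZ) (neq0 _ _ _ s).
  by split=> [/h'/h|/h/h'].
Qed.

Lemma embedding_quotient g : regular Omega g ->
  hmap f (cls_regular (PFun Omega g)) =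
  cls_quotient (quotient I J Omega (fun=> 1) g).
Proof.
move=> rg; have [X gE] := regular_hev hI axO rg.
have oneE L z : imag_unit L -> D z -> (1 : quat R) = ev L (hev z (1 : hq (sfun Dm))).
  by move=> hL Dz; rewrite hev1// -hc1 ev_hc emb1.
have N0 : hnorm (1 : hq (sfun Dm)) != 0 by rewrite hnorm1 oner_neq0.
rewrite (cls_regularE (represents_regular axO gE)).
rewrite (cls_quotientE (represents_quotient hI hJ hIJ axO oneE gE N0)).
rewrite -hfrac1; apply/(hfrac_eq f_inj _ _ (oner_neq0 _) N0).
by rewrite hnorm1 -hc1 hconj_hc hc1 !mul1r.
Qed.

End presentation.

Lemma slice_stem_domain (R : realType) (Omega : set (quat R)) (I : quat R) :
  symmetric_set Omega -> slice_domain Omega -> imag_unit I ->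
  stem_domain (slice Omega I).
Proof.
move=> sO [_ [x Ox] sl] hI; have [oD cD] := sl I hI; split => //.
- move=> z; rewrite /slice /= -qpointN; apply: sO => //; exact: imag_unitN.
- by exists x; rewrite /slice /= qpoint_real.
Qed.

Lemma symmetric_axial (R : realType) (Omega : set (quat R)) (I : quat R) :
  symmetric_set Omega -> imag_unit I -> axial Omega (slice Omega I).
Proof.
by move=> sO hI K hK; rewrite eqEsubset; split=> z; exact: sO.
Qed.

Theorem theorem4p5 (R : realType) (Omega : set (quat R))
    (Omega_sym : symmetric_set Omega) (Omega_slice : slice_domain Omega)
    (I J : quat R) (I_unit : imag_unit I) (J_unit : imag_unit J)
    (IJ_orth : qdot I J = 0) :
  exists (D : nzRingType) (clsD : pfun R -> D)
         (L : unitRingType) (clsL : pfun R -> L) (iota : {rmorphism D -> L}),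
  [/\ presents I J (regular_functions Omega) clsD,
      presents I J (star_quotients I J Omega) clsL,
      division_ring L,
      left_Ore_domain D /\ right_Ore_domain D
    & [/\ forall f, regular Omega f ->
            iota (clsD (PFun Omega f)) = clsL (quotient I J Omega (fun=> 1) f),
          left_quotient_ring iota
        & right_quotient_ring iota]].
Proof.
pose Dm := SDom (slice_stem_domain Omega_sym Omega_slice I_unit).
have axO : axial Omega (sdom_set Dm) by exact: symmetric_axial.
have [K [f [f_inj f_frac]]] : exists (K : fieldType) (f : {rmorphism sfun Dm -> K}),
    injective f /\ forall r : K, exists n d : sfun Dm, d != 0 /\ r = f n / f d.
  exists {fraction (sfun Dm)}, (@FracField.tofrac (sfun Dm)); split.
    by move=> n m /eqP; rewrite tofrac_eq => /eqP.
  exact: tofrac_frac.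
have sq := @sfun_sum4sq _ Dm.
exists (hq (sfun Dm)), (@cls_regular _ Dm), (hq K), (cls_quotient f), (hmap f).
split.
- exact: presents_regular_functions.
- exact: presents_star_quotients.
- exact: hq_division f_frac.
- by split; [exact: hq_left_Ore|exact: hq_right_Ore].
- split; first by move=> g; exact: embedding_quotient.
  + exact: hq_left_quotient.
  + exact: hq_right_quotient.
Qed.
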